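(* Let $\ell,\ell'$ be geodesic lines of $\mathbb{H}^2$ and $g,g'\in G_0$. Consider: (C) the right $\mathrm{AdS}$ crooked planes $g\mathsf{C}^*(\ell)$ and $g'\mathsf{C}^*(\ell')$ are disjoint; (D) the geodesic lines $\ell$ and $\ell'$ are disjoint, and $g^{-1}g'\in\mathsf{SQ}(\ell)\,\mathsf{SQ}(\ell')^{-1}$ for the transverse orientations of $\ell,\ell'$ pointing away from each other. Then (C) implies (D). Moreover, if $g$ and $g'$ take $\ell$ and $\ell'$ to disjoint geodesics $g\cdot\ell$, $g'\cdot\ell'$ whose transverse orientations (induced by $g,g'$ from those of $\ell,\ell'$ pointing away from each other) point away from each other, then (D) implies (C).
   Context: $G_0=\mathrm{PSL}_2(\mathbb{R})$ acts on the hyperbolic plane $\mathbb{H}^2$; $\mathrm{AdS}^3$ is identified with $G_0$. For a geodesic line $\ell$ with closure $\overline\ell$ in $\mathbb{H}^2\cup\partial_\infty\mathbb{H}^2$, $\mathsf{C}^*(\ell)$ is the set of $h\in G_0$ having a nonattracting fixed point in $\overline\ell$ (identity: every point; elliptic: its fixed point; parabolic: its fixed point at infinity; hyperbolic: its repelling fixed point). For a transversely oriented geodesic line $\ell$, the stem quadrant $\mathsf{SQ}(\ell)\subset G_0$ is the set of hyperbolic elements whose translation axis is orthogonal to $\ell$ and which translate towards the positive side of $\ell$. For subsets $A,B\subset G_0$, $AB=\{ab\}$ and $A^{-1}=\{a^{-1}\}$. *)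

(* Defs.v *)
From Stdlib Require Import Reals Lra Psatz.
Open Scope R_scope.

(* ---------- G0 = PSL_2(R): SL_2(R) matrices, compared up to sign ---------- *)
Record SL2 := mkSL2 { ma : R; mb : R; mc : R; md : R;
                      mdet : ma * md - mb * mc = 1 }.

Lemma smul_det (g h : SL2) :
  (ma g * ma h + mb g * mc h) * (mc g * mb h + md g * md h)
  - (ma g * mb h + mb g * md h) * (mc g * ma h + md g * mc h) = 1.
Proof.
  destruct g as [a b c d Hg], h as [a' b' c' d' Hh]; simpl.
  replace ((a * a' + b * c') * (c * b' + d * d') - (a * b' + b * d') * (c * a' + d * c'))
    with ((a * d - b * c) * (a' * d' - b' * c')) by ring.
  rewrite Hg, Hh; ring.
Qed.

Definition smul (g h : SL2) : SL2 :=
  mkSL2 _ _ _ _ (smul_det g h).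

Lemma sinv_det (g : SL2) : md g * ma g - (- mb g) * (- mc g) = 1.
Proof. destruct g as [a b c d H]; simpl; rewrite <- H; ring. Qed.

Definition sinv (g : SL2) : SL2 := mkSL2 _ _ _ _ (sinv_det g).

Definition peq (g h : SL2) : Prop :=
  (ma g = ma h /\ mb g = mb h /\ mc g = mc h /\ md g = md h) \/
  (ma g = - ma h /\ mb g = - mb h /\ mc g = - mc h /\ md g = - md h).

Definition is_identity (g : SL2) : Prop :=
  (ma g = 1 /\ mb g = 0 /\ mc g = 0 /\ md g = 1) \/
  (ma g = -1 /\ mb g = 0 /\ mc g = 0 /\ md g = -1).

Definition elliptic (g : SL2) : Prop := Rabs (ma g + md g) < 2.
Definition parabolic (g : SL2) : Prop :=
  Rabs (ma g + md g) = 2 /\ ~ is_identity g.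
Definition hyperbolic (g : SL2) : Prop := Rabs (ma g + md g) > 2.

Record Hpt := mkH { hx : R; hy : R; hy_pos : 0 < hy }.

Definition hpeq (z w : Hpt) : Prop := hx z = hx w /\ hy z = hy w.

Definition act_den (g : SL2) (z : Hpt) : R :=
  (mc g * hx z + md g) * (mc g * hx z + md g) + (mc g * hy z) * (mc g * hy z).

Lemma act_den_pos (g : SL2) (z : Hpt) : 0 < act_den g z.
Proof.
  destruct g as [a b c d H], z as [x y Hy]; unfold act_den; simpl.
  destruct (Req_dec c 0) as [Hc|Hc].
  - subst c. assert (d <> 0) by (intro; subst; nra).
    assert (0 < d * d) by (apply Rsqr_pos_lt; exact H0).
    pose proof (Rle_0_sqr (0 * y)). unfold Rsqr in *. nra.
  - assert (0 < c * y * (c * y)).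
    { apply Rsqr_pos_lt. apply Rmult_integral_contrapositive; split; lra. }
    pose proof (Rle_0_sqr (c * x + d)). unfold Rsqr in *. lra.
Qed.

Lemma act_y_pos (g : SL2) (z : Hpt) : 0 < hy z / act_den g z.
Proof. apply Rdiv_lt_0_compat; [apply hy_pos | apply act_den_pos]. Qed.

(* Moebius action z |-> (a z + b)/(c z + d) *)
Definition act (g : SL2) (z : Hpt) : Hpt :=
  mkH (((ma g * hx z + mb g) * (mc g * hx z + md g)
         + ma g * mc g * (hy z * hy z)) / act_den g z)
      (hy z / act_den g z) (act_y_pos g z).

(* ---------- Boundary at infinity = RP^1 (nonzero vectors up to scaling) ---------- *)
Record Bpt := mkB { b1 : R; b2 : R; b_nz : ~ (b1 = 0 /\ b2 = 0) }.

(* [u1 : u2] represents the point u1/u2 of R cup {oo} *)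
Definition bpeq (u v : Bpt) : Prop := b1 u * b2 v - b2 u * b1 v = 0.

Lemma actB_nz (g : SL2) (u : Bpt) :
  ~ (ma g * b1 u + mb g * b2 u = 0 /\ mc g * b1 u + md g * b2 u = 0).
Proof.
  destruct g as [a b c d H], u as [u1 u2 Hu]; simpl. intros [H1 H2]. apply Hu.
  assert (E1 : u1 = d * (a * u1 + b * u2) - b * (c * u1 + d * u2)).
  { replace u1 with (u1 * 1) at 1 by ring. rewrite <- H. ring. }
  assert (E2 : u2 = a * (c * u1 + d * u2) - c * (a * u1 + b * u2)).
  { replace u2 with (u2 * 1) at 1 by ring. rewrite <- H. ring. }
  rewrite H1, H2 in E1, E2. split; lra.
Qed.

Definition actB (g : SL2) (u : Bpt) : Bpt :=
  mkB (ma g * b1 u + mb g * b2 u) (mc g * b1 u + md g * b2 u) (actB_nz g u).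

Definition fixedB (g : SL2) (u : Bpt) : Prop := bpeq (actB g u) u.

Definition repelling_pt (g : SL2) (u : Bpt) : Prop :=
  exists lam : R, Rabs lam < 1 /\
    ma g * b1 u + mb g * b2 u = lam * b1 u /\ mc g * b1 u + md g * b2 u = lam * b2 u.
Definition attracting_pt (g : SL2) (u : Bpt) : Prop :=
  exists lam : R, Rabs lam > 1 /\
    ma g * b1 u + mb g * b2 u = lam * b1 u /\ mc g * b1 u + md g * b2 u = lam * b2 u.

Record Geod := mkG { ge1 : Bpt; ge2 : Bpt; ge_dist : ~ bpeq ge1 ge2 }.

(* F u w (x,y) = 0 is the equation of the geodesic with endpoints u, w:
   for u = [a:1], w = [b:1] it is (x-a)(x-b)+y^2 = 0 (semicircle),
   for u = [1:0] (oo), w = [b:1] it is x = b (vertical line). *)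
Definition Fq (u w : Bpt) (x y : R) : R :=
  (x * b2 u - b1 u) * (x * b2 w - b1 w) + y * y * b2 u * b2 w.

Definition gradF1 (u w : Bpt) (x y : R) : R :=
  b2 u * (x * b2 w - b1 w) + b2 w * (x * b2 u - b1 u).
Definition gradF2 (u w : Bpt) (x y : R) : R := 2 * y * b2 u * b2 w.

Definition onG (l : Geod) (z : Hpt) : Prop := Fq (ge1 l) (ge2 l) (hx z) (hy z) = 0.

Definition endpt (l : Geod) (u : Bpt) : Prop := bpeq u (ge1 l) \/ bpeq u (ge2 l).

Definition geod_disjoint (l l' : Geod) : Prop := forall z, ~ (onG l z /\ onG l' z).

Definition opp_side (l : Geod) (z w : Hpt) : Prop :=
  Fq (ge1 l) (ge2 l) (hx z) (hy z) * Fq (ge1 l) (ge2 l) (hx w) (hy w) < 0.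

(* positive open half-plane of l for the transverse orientation pointing away from l' *)
Definition posside (l l' : Geod) (z : Hpt) : Prop :=
  forall w, onG l' w -> opp_side l z w.

Lemma gmap_dist (g : SL2) (l : Geod) : ~ bpeq (actB g (ge1 l)) (actB g (ge2 l)).
Proof.
  destruct l as [u w Huw]; unfold bpeq in *; simpl.
  destruct g as [a b c d H]; simpl.
  replace ((a * b1 u + b * b2 u) * (c * b1 w + d * b2 w) -
           (c * b1 u + d * b2 u) * (a * b1 w + b * b2 w))
    with ((a * d - b * c) * (b1 u * b2 w - b2 u * b1 w)) by ring.
  rewrite H. rewrite Rmult_1_l. exact Huw.
Qed.

Definition gmap (g : SL2) (l : Geod) : Geod := mkG _ _ (gmap_dist g l).

(* h has a nonattracting fixed point in the closure of l:
   identity: every point; elliptic: its fixed point in H^2;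
   parabolic: its fixed point at infinity; hyperbolic: its repelling fixed point *)
Definition Cstar (l : Geod) (h : SL2) : Prop :=
  is_identity h \/
  (elliptic h /\ exists z, onG l z /\ hpeq (act h z) z) \/
  (parabolic h /\ exists u, fixedB h u /\ endpt l u) \/
  (hyperbolic h /\ exists u, repelling_pt h u /\ endpt l u).

(* ---------- Stem quadrant SQ(l) for the transverse orientation with positive
   open half-plane P ---------- *)
Definition on_axis (h : SL2) (z : Hpt) : Prop :=
  exists r a : Bpt, repelling_pt h r /\ attracting_pt h a /\ Fq r a (hx z) (hy z) = 0.

(* axis of h orthogonal to l, meeting l at z (angles in the conformal upper
   half-plane model are Euclidean angles: normals are perpendicular) *)
Definition axis_orth_at (h : SL2) (l : Geod) (z : Hpt) : Prop :=
  onG l z /\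
  exists r a : Bpt, repelling_pt h r /\ attracting_pt h a /\ Fq r a (hx z) (hy z) = 0 /\
    gradF1 r a (hx z) (hy z) * gradF1 (ge1 l) (ge2 l) (hx z) (hy z)
    + gradF2 r a (hx z) (hy z) * gradF2 (ge1 l) (ge2 l) (hx z) (hy z) = 0.

Definition SQ (l : Geod) (P : Hpt -> Prop) (h : SL2) : Prop :=
  hyperbolic h /\ exists z, axis_orth_at h l z /\ P (act h z).

(* Main.v *)
Require Import Defs.
From Stdlib Require Import Reals Lra Psatz Eqdep_dec.
Open Scope R_scope.

(* Let [p, q] and [p', q'] span the endpoints of [l] and [l'], and write [x ^ y] for the
   determinant of two vectors. Disjointness of the crooked planes is equivalent to the four
   inequalities [|g x ^ g' y| < |x ^ y|], [x] in [{p, q}], [y] in [{p', q'}]. If one fails,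
   matrices fixing the endpoints [x] and [y] (or a rotation about a point of [l'], when
   [x = y]) give a common point. Conversely an element of C*(l) contracts a nonzero form
   [s p p^T + r q q^T], and the invariant pairing of two such forms is a nonnegative
   combination of the [(x ^ y)^2].
   After a choice of signs, the elements of SQ(l) are, in the basis [p, q] and up to sign,
   the matrices of determinant one with positive entries and equal diagonal entries. So (D)
   says that [N = (x ^ y)] is [A N' B] up to sign, with [N' = (g x ^ g' y)] and [A], [B] of
   this type. If [N'] has nonnegative entries, then [A] and [B] increase them. Conversely, when
   the entries of [N'] are smaller in absolute value than those of [N], row and column
   scalings reduce the search for [A] and [B] to a symmetric one-parameter family. *)

(** * Matrices and the determinant pairing of boundary vectors *)

Lemma sqr_pos (x : R) : x <> 0 -> 0 < x ^ 2.
Proof. intros H; rewrite <- Rsqr_pow2; now apply Rsqr_pos_lt. Qed.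

(** The determinant proofs agree because equality on [R] is decidable, which makes identity proofs
    unique. *)
Lemma SL2_eq (g h : SL2) :
  ma g = ma h -> mb g = mb h -> mc g = mc h -> md g = md h -> g = h.
Proof.
  destruct g as [a b c d Hg], h as [a' b' c' d' Hh]; simpl.
  intros -> -> -> ->; f_equal; apply UIP_dec, Req_EM_T.
Qed.

Lemma sneg_det (g : SL2) : - ma g * - md g - - mb g * - mc g = 1.
Proof. rewrite <- (mdet g); ring. Qed.

Definition sneg (g : SL2) : SL2 := mkSL2 _ _ _ _ (sneg_det g).

Lemma peq_cases (g h : SL2) : peq g h <-> g = h \/ g = sneg h.
Proof.
  split.
  - intros [(?&?&?&?)|(?&?&?&?)]; [left|right]; apply SL2_eq; simpl; assumption.
  - intros [->| ->]; [left|right]; simpl; auto.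
Qed.

Lemma smulA (f g h : SL2) : smul f (smul g h) = smul (smul f g) h.
Proof. apply SL2_eq; simpl; ring. Qed.

Lemma smul_sinvK (g h : SL2) : smul (sinv g) (smul g h) = h.
Proof.
  pose proof (mdet g) as E.
  apply SL2_eq; simpl;
    [set (t := ma h)|set (t := mb h)|set (t := mc h)|set (t := md h)];
    replace t with ((ma g * md g - mb g * mc g) * t) at 3 by (rewrite E; ring);
    unfold t; ring.
Qed.

Lemma smul_sinvKV (g h : SL2) : smul g (smul (sinv g) h) = h.
Proof.
  pose proof (mdet g) as E.
  apply SL2_eq; simpl;
    [set (t := ma h)|set (t := mb h)|set (t := mc h)|set (t := md h)];
    replace t with ((ma g * md g - mb g * mc g) * t) at 3 by (rewrite E; ring);
    unfold t; ring.
Qed.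

Lemma smul_K_sinv (g h : SL2) : smul (smul g h) (sinv h) = g.
Proof.
  pose proof (mdet h) as E.
  apply SL2_eq; simpl;
    [set (t := ma g)|set (t := mb g)|set (t := mc g)|set (t := md g)];
    replace t with ((ma h * md h - mb h * mc h) * t) at 3 by (rewrite E; ring);
    unfold t; ring.
Qed.

Lemma smul_sneg (g h : SL2) : smul g (sneg h) = sneg (smul g h).
Proof. apply SL2_eq; simpl; ring. Qed.

Lemma sneg_smul (g h : SL2) : smul (sneg g) h = sneg (smul g h).
Proof. apply SL2_eq; simpl; ring. Qed.

Definition wd (u v : Bpt) : R := b1 u * b2 v - b2 u * b1 v.

Lemma wd_act (g : SL2) (u v : Bpt) : wd (actB g u) (actB g v) = wd u v.
Proof.
  unfold wd; simpl.
  replace (b1 u * b2 v - b2 u * b1 v)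
    with ((ma g * md g - mb g * mc g) * (b1 u * b2 v - b2 u * b1 v))
    by (rewrite (mdet g); ring).
  ring.
Qed.

Lemma ge_wd (l : Geod) : wd (ge1 l) (ge2 l) <> 0.
Proof. exact (ge_dist l). Qed.

Lemma Bpt_norm_pos (u : Bpt) : 0 < b1 u ^ 2 + b2 u ^ 2.
Proof.
  destruct u as [x y H]; simpl.
  destruct (Req_dec x 0), (Req_dec y 0); try tauto; nra.
Qed.

Lemma wd_parallel (u v : Bpt) :
  wd u v = 0 -> exists k, k <> 0 /\ b1 v = k * b1 u /\ b2 v = k * b2 u.
Proof.
  intros H; pose proof (Bpt_norm_pos u) as N; pose proof (Bpt_norm_pos v) as N'.
  unfold wd in H.
  set (n := b1 u ^ 2 + b2 u ^ 2) in *.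
  (* The factor is the coefficient of the orthogonal projection of [v] on [u]. *)
  assert (E1 : b1 v = (b1 u * b1 v + b2 u * b2 v) / n * b1 u).
  { transitivity ((n * b1 v + b2 u * (b1 u * b2 v - b2 u * b1 v)) / n).
    - rewrite H; field; lra.
    - unfold n; field; fold n; lra. }
  assert (E2 : b2 v = (b1 u * b1 v + b2 u * b2 v) / n * b2 u).
  { transitivity ((n * b2 v - b1 u * (b1 u * b2 v - b2 u * b1 v)) / n).
    - rewrite H; field; lra.
    - unfold n; field; fold n; lra. }
  eexists; split; [|split; [exact E1|exact E2]].
  intros K; rewrite K in E1, E2; rewrite E1, E2 in N'; lra.
Qed.

Lemma wd_basis (p q : Bpt) (x y : R) :
  wd p q <> 0 -> b1 p * y - b2 p * x = 0 -> b1 q * y - b2 q * x = 0 -> x = 0 /\ y = 0.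
Proof.
  unfold wd; intros W H1 H2.
  split; apply (Rmult_eq_reg_l (b1 p * b2 q - b2 p * b1 q)); trivial.
  - transitivity (b1 q * (b1 p * y - b2 p * x) - b1 p * (b1 q * y - b2 q * x)); [ring|].
    rewrite H1, H2; ring.
  - transitivity (b2 q * (b1 p * y - b2 p * x) - b2 p * (b1 q * y - b2 q * x)); [ring|].
    rewrite H1, H2; ring.
Qed.

(** Cramer's rule; the matrix has determinant one because the images span the same area as [p],
    [q]. *)
Lemma SL2_of_images (p q : Bpt) (u1 u2 v1 v2 : R) :
  wd p q <> 0 -> u1 * v2 - u2 * v1 = wd p q ->
  exists h : SL2, (b1 (actB h p) = u1 /\ b2 (actB h p) = u2) /\
                  (b1 (actB h q) = v1 /\ b2 (actB h q) = v2).
Proof.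
  intros W E.
  assert (D : (u1 * b2 q - v1 * b2 p) / wd p q * ((v2 * b1 p - u2 * b1 q) / wd p q)
            - (v1 * b1 p - u1 * b1 q) / wd p q * ((u2 * b2 q - v2 * b2 p) / wd p q) = 1).
  { transitivity ((u1 * v2 - u2 * v1) / wd p q).
    - unfold wd in *; field; exact W.
    - rewrite E; field; exact W. }
  exists (mkSL2 _ _ _ _ D); simpl; unfold wd in *; repeat split; field; exact W.
Qed.

(** Lets an argument about the first endpoints of two lines yield all four pairs of endpoints. *)
Definition gswap (l : Geod) : Geod.
Proof.
  refine (mkG (ge2 l) (ge1 l) _).
  intros H; apply (ge_dist l); unfold bpeq in *; lra.
Defined.

Lemma Cstar_gswap (l : Geod) (h : SL2) : Cstar (gswap l) h -> Cstar l h.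
Proof.
  unfold Cstar; intros [H|[[H [z [Hz Hf]]]|[[H [u [Hu He]]]|[H [u [Hu He]]]]]].
  - now left.
  - right; left; split; trivial; exists z; split; trivial.
    unfold onG, Fq in *; simpl in Hz; rewrite <- Hz; ring.
  - right; right; left; split; trivial; exists u; split; trivial.
    unfold endpt in *; simpl in He; tauto.
  - right; right; right; split; trivial; exists u; split; trivial.
    unfold endpt in *; simpl in He; tauto.
Qed.

(** The adjugate of [h - lam] applied to [(h - lam) x] is the characteristic polynomial at [lam]
    times [x], and [x] is nonzero. *)
Lemma eigen_charpoly (h : SL2) (x : Bpt) (lam : R) :
  b1 (actB h x) = lam * b1 x -> b2 (actB h x) = lam * b2 x ->
  lam * lam - (ma h + md h) * lam + 1 = 0.
Proof.
  simpl; intros E1 E2.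
  pose proof (mdet h) as D. pose proof (Bpt_norm_pos x) as N.
 assert (T1 : (lam * lam - (ma h + md h) * lam + 1) * b1 x = 0).
  { rewrite <- D.
    transitivity ((md h - lam) * (ma h * b1 x + mb h * b2 x - lam * b1 x)
                  - mb h * (mc h * b1 x + md h * b2 x - lam * b2 x)); [ring|].
    rewrite E1, E2; ring. }
  assert (T2 : (lam * lam - (ma h + md h) * lam + 1) * b2 x = 0).
  { rewrite <- D.
    transitivity ((ma h - lam) * (mc h * b1 x + md h * b2 x - lam * b2 x)
                  - mc h * (ma h * b1 x + mb h * b2 x - lam * b1 x)); [ring|].
    rewrite E1, E2; ring. }
  apply Rmult_integral in T1, T2. destruct T1 as [?|T1], T2 as [?|T2]; trivial.
  rewrite T1, T2 in N; lra.
Qed.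

(** The trace is [lam + 1 / lam]: if [|lam| < 1], then [h] is hyperbolic with [x] repelling; if
    [lam] is 1 or -1, then [h] is parabolic or the identity. *)
Lemma eigen_Cstar (l : Geod) (h : SL2) (x : Bpt) (lam : R) :
  endpt l x -> Rabs lam <= 1 ->
  b1 (actB h x) = lam * b1 x -> b2 (actB h x) = lam * b2 x -> Cstar l h.
Proof.
  intros Hx Hl E1 E2.
  pose proof (eigen_charpoly h x lam E1 E2) as T.
  destruct (Rlt_dec (Rabs lam) 1) as [L|L].
  - right; right; right; split.
    + unfold hyperbolic. destruct (Rlt_or_le 0 lam).
      * rewrite Rabs_pos_eq in L by lra.
        assert (2 < ma h + md h) by nra. rewrite Rabs_pos_eq; lra.
      * rewrite Rabs_left1 in L by lra.
        assert (ma h + md h < -2) by nra. rewrite Rabs_left; lra.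
    + exists x; split; trivial. now exists lam; split; [|split].
  - assert (lam = 1 \/ lam = -1) as Hlam.
    { destruct (Rle_lt_dec 0 lam);
        [rewrite Rabs_pos_eq in * by lra|rewrite Rabs_left in * by lra]; lra. }
    assert (Hd : is_identity h \/ ~ is_identity h).
    { unfold is_identity.
      destruct (Req_dec (ma h) 1), (Req_dec (ma h) (-1)), (Req_dec (mb h) 0),
        (Req_dec (mc h) 0), (Req_dec (md h) 1), (Req_dec (md h) (-1)); tauto. }
    destruct Hd as [Hd|Hd]; [now left|]. right; right; left; split.
    + split; trivial. destruct Hlam; subst lam.
      * rewrite Rabs_pos_eq; lra.
      * rewrite Rabs_left; lra.
    + exists x; split; trivial. unfold fixedB, bpeq. rewrite E1, E2; ring.
Qed.

(** * Geodesics and quadratic forms *)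

Definition f11 (s r : R) (u v : Bpt) : R := s * b1 u ^ 2 + r * b1 v ^ 2.
Definition f12 (s r : R) (u v : Bpt) : R := s * (b1 u * b2 u) + r * (b1 v * b2 v).
Definition f22 (s r : R) (u v : Bpt) : R := s * b2 u ^ 2 + r * b2 v ^ 2.

(* [z] is the point of the hyperbolic plane whose matrix
   [(x^2 + y^2, x; x, 1)] is [s u u^T + r v v^T]. *)
Definition form_pt (z : Hpt) (s r : R) (u v : Bpt) : Prop :=
  hx z ^ 2 + hy z ^ 2 = f11 s r u v /\ hx z = f12 s r u v /\ 1 = f22 s r u v.

(** [Fq P Q] is the bilinear form of the adjugate of the matrix of [z], evaluated at [P] and [Q]; a
    summand [u u^T] contributes [(P ^ u) (Q ^ u)]. *)
Lemma Fq_form (z : Hpt) (s r : R) (u v P Q : Bpt) :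
  form_pt z s r u v ->
  Fq P Q (hx z) (hy z) = s * (wd P u * wd Q u) + r * (wd P v * wd Q v).
Proof.
  intros (E1 & E2 & E3); unfold f11, f12, f22, wd, Fq in *.
  transitivity ((hx z ^ 2 + hy z ^ 2) * (b2 P * b2 Q)
                - hx z * (b2 P * b1 Q + b1 P * b2 Q) + 1 * (b1 P * b1 Q)); [ring|].
  rewrite E1, E3, E2; ring.
Qed.

Lemma wd_self (u : Bpt) : wd u u = 0.
Proof. unfold wd; ring. Qed.

Lemma wd_anti (u v : Bpt) : wd v u = - wd u v.
Proof. unfold wd; ring. Qed.

Lemma form_onG (l : Geod) (z : Hpt) (s r : R) :
  form_pt z s r (ge1 l) (ge2 l) -> onG l z.
Proof.
  intros H; unfold onG; rewrite (Fq_form _ _ _ _ _ _ _ H), !wd_self; ring.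
Qed.

(** Membership in [l] says that the matrix of [z] is diagonal in the basis of endpoint vectors;
    positive definiteness makes the weights positive. *)
Lemma onG_form (l : Geod) (z : Hpt) :
  onG l z -> exists s r, 0 < s /\ 0 < r /\ form_pt z s r (ge1 l) (ge2 l).
Proof.
  pose proof (ge_wd l) as W; unfold onG, Fq, form_pt, f11, f12, f22.
  generalize (Bpt_norm_pos (ge1 l)) (Bpt_norm_pos (ge2 l)).
  unfold wd in W; revert W.
  generalize (b1 (ge1 l)) (b2 (ge1 l)) (b1 (ge2 l)) (b2 (ge2 l)).
  intros p1 p2 q1 q2 W Np Nq H.
  pose proof (hy_pos z) as Y; set (x := hx z) in *; set (y := hy z) in *.
  set (w := p1 * q2 - p2 * q1) in *.
  pose proof (sqr_pos w W) as W2.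
  assert (pos : forall a b, 0 < a ^ 2 + b ^ 2 -> 0 < (a - x * b) ^ 2 + y ^ 2 * b ^ 2).
  { intros a b Hab. destruct (Req_dec b 0) as [-> |B].
    - rewrite Rmult_0_r; nra.
    - assert (0 < y ^ 2 * b ^ 2) by (apply Rmult_lt_0_compat; apply sqr_pos; lra).
      pose proof (pow2_ge_0 (a - x * b)); lra. }
  pose (P := x * p2 - p1); pose (Q := x * q2 - q1).
  assert (Ew : w ^ 2 = p2 ^ 2 * (Q ^ 2 + y ^ 2 * q2 ^ 2) + q2 ^ 2 * (P ^ 2 + y ^ 2 * p2 ^ 2)).
  { transitivity (p2 ^ 2 * Q ^ 2 + q2 ^ 2 * P ^ 2 - 2 * (P * Q) * p2 * q2).
    - unfold w, P, Q; ring.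
    - replace (P * Q) with (- (y * y * p2 * q2)) by (unfold P, Q; lra). ring. }
  assert (E : (x * p2 - p1) * (x * q2 - q1) = - (y * y * p2 * q2)) by lra.
  (* With [z = x + i y] the weights are [|q1 - q2 z|^2 / w^2] and [|p1 - p2 z|^2 / w^2]: evaluating
     [Fq] at [q], [q] kills the [q] term, and likewise for [p]. *)
  exists (((q1 - x * q2) ^ 2 + y ^ 2 * q2 ^ 2) / w ^ 2),
         (((p1 - x * p2) ^ 2 + y ^ 2 * p2 ^ 2) / w ^ 2).
  split; [apply Rdiv_lt_0_compat; auto|]. split; [apply Rdiv_lt_0_compat; auto|].
  assert (Z22 : 1 = ((q1 - x * q2) ^ 2 + y ^ 2 * q2 ^ 2) / w ^ 2 * p2 ^ 2
                  + ((p1 - x * p2) ^ 2 + y ^ 2 * p2 ^ 2) / w ^ 2 * q2 ^ 2).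
  { apply (Rmult_eq_reg_r (w ^ 2)); [|lra]. field_simplify; [|exact W].
    rewrite Ew; unfold P, Q; ring. }
  assert (Z12 : x = ((q1 - x * q2) ^ 2 + y ^ 2 * q2 ^ 2) / w ^ 2 * (p1 * p2)
                  + ((p1 - x * p2) ^ 2 + y ^ 2 * p2 ^ 2) / w ^ 2 * (q1 * q2)).
  { apply (Rmult_eq_reg_r (w ^ 2)); [|lra].
    transitivity (((q1 - x * q2) ^ 2 + y ^ 2 * q2 ^ 2) * (p1 * p2)
                  + ((p1 - x * p2) ^ 2 + y ^ 2 * p2 ^ 2) * (q1 * q2)).
    - replace p1 with (x * p2 - P) at 1 2 by (unfold P; ring).
      replace q1 with (x * q2 - Q) at 1 2 by (unfold Q; ring).
      rewrite Ew. fold P Q in E.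
      transitivity (x * (p2 ^ 2 * (Q ^ 2 + y ^ 2 * q2 ^ 2) + q2 ^ 2 * (P ^ 2 + y ^ 2 * p2 ^ 2))
        - (P * Q + y * y * p2 * q2) * (Q * p2 + P * q2)).
      + rewrite E; ring.
      + unfold P, Q; ring.
    - field; exact W. }
  split; [|split; assumption].
  set (s := ((q1 - x * q2) ^ 2 + y ^ 2 * q2 ^ 2) / w ^ 2) in *.
  set (r := ((p1 - x * p2) ^ 2 + y ^ 2 * p2 ^ 2) / w ^ 2) in *.
  (* The remaining entry follows from the determinant and the two entries already found. *)
  assert (Edet : s * r * w ^ 2 = y ^ 2).
  { transitivity (((P * Q + y * y * p2 * q2) ^ 2 + y ^ 2 * w ^ 2) / w ^ 2).
    - unfold s, r, P, Q, w; field; exact W.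
    - fold P Q in E; rewrite E; field; exact W. }
  transitivity ((s * (p1 * p2) + r * (q1 * q2)) ^ 2 + s * r * w ^ 2).
  - rewrite <- Z12, Edet; ring.
  - transitivity ((s * p1 ^ 2 + r * q1 ^ 2) * (s * p2 ^ 2 + r * q2 ^ 2));
      [unfold w; ring|rewrite <- Z22; ring].
Qed.

Lemma f11_act (g : SL2) (s r : R) (u v : Bpt) :
  f11 s r (actB g u) (actB g v)
  = ma g ^ 2 * f11 s r u v + 2 * (ma g * mb g) * f12 s r u v + mb g ^ 2 * f22 s r u v.
Proof. unfold f11, f12, f22; simpl; ring. Qed.

Lemma f12_act (g : SL2) (s r : R) (u v : Bpt) :
  f12 s r (actB g u) (actB g v)
  = ma g * mc g * f11 s r u v + (ma g * md g + mb g * mc g) * f12 s r u v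
    + mb g * md g * f22 s r u v.
Proof. unfold f11, f12, f22; simpl; ring. Qed.

Lemma f22_act (g : SL2) (s r : R) (u v : Bpt) :
  f22 s r (actB g u) (actB g v)
  = mc g ^ 2 * f11 s r u v + 2 * (mc g * md g) * f12 s r u v + md g ^ 2 * f22 s r u v.
Proof. unfold f11, f12, f22; simpl; ring. Qed.

Lemma form_det (s r : R) (u v : Bpt) :
  f11 s r u v * f22 s r u v - f12 s r u v ^ 2 = s * r * wd u v ^ 2.
Proof. unfold f11, f12, f22, wd; ring. Qed.

Lemma form_pt_det (z : Hpt) (s r : R) (u v : Bpt) :
  form_pt z s r u v -> s * r * wd u v ^ 2 = hy z ^ 2.
Proof.
  intros (E1 & E2 & E3); rewrite <- form_det, <- E1, <- E2, <- E3; ring.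
Qed.

Lemma form_act_den (g : SL2) (z : Hpt) (s r : R) (u v : Bpt) :
  form_pt z s r u v -> f22 s r (actB g u) (actB g v) = act_den g z.
Proof.
  intros (E1 & E2 & E3); rewrite f22_act, <- E1, <- E2, <- E3; unfold act_den; ring.
Qed.

Lemma f_div (d s r : R) (u v : Bpt) :
  d <> 0 -> f11 (s / d) (r / d) u v = f11 s r u v / d /\
  f12 (s / d) (r / d) u v = f12 s r u v / d /\ f22 (s / d) (r / d) u v = f22 s r u v / d.
Proof. intros H; unfold f11, f12, f22; repeat split; field; exact H. Qed.

(** The Moebius action is [Z -> g Z g^T] on matrices of points, followed by the division that makes
    the lower right entry one again; the determinant gives the height. *)
Lemma form_act (g : SL2) (z : Hpt) (s r : R) (u v : Bpt) :
  form_pt z s r u v ->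
  form_pt (act g z) (s / act_den g z) (r / act_den g z) (actB g u) (actB g v).
Proof.
  intros H. pose proof (act_den_pos g z) as Dp.
  pose proof (form_act_den g z s r u v H) as ED.
  pose proof (form_det s r (actB g u) (actB g v)) as Edet.
  rewrite wd_act, (form_pt_det _ _ _ _ _ H), ED in Edet.
  destruct (f_div (act_den g z) s r (actB g u) (actB g v)) as (F1 & F2 & F3); [lra|].
  unfold form_pt; rewrite F1, F2, F3, ED.
  assert (Ex : hx (act g z) = f12 s r (actB g u) (actB g v) / act_den g z).
  { destruct H as (E1 & E2 & E3). simpl; f_equal.
    rewrite f12_act, <- E1, <- E2, <- E3; ring. }
  rewrite Ex; split; [|split; [reflexivity|field; lra]].
  simpl hy.
  transitivity ((f12 s r (actB g u) (actB g v) ^ 2 + hy z ^ 2) / act_den g z ^ 2);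
    [field; lra|].
  rewrite <- Edet; field; lra.
Qed.

(** Dividing a positive definite form by its entry [f22] gives the matrix of a point, whose height
    is the square root of the determinant over [f22]. *)
Lemma geod_pt (l : Geod) (s r : R) :
  0 < s -> 0 < r ->
  exists z k, 0 < k /\ form_pt z (k * s) (k * r) (ge1 l) (ge2 l).
Proof.
  intros Hs Hr.
  pose proof (sqr_pos _ (ge_wd l)) as W. pose proof (form_det s r (ge1 l) (ge2 l)) as E.
  set (D := f22 s r (ge1 l) (ge2 l)) in *.
  assert (P : 0 < s * r * wd (ge1 l) (ge2 l) ^ 2).
  { apply Rmult_lt_0_compat; [now apply Rmult_lt_0_compat|exact W]. }
  assert (D0 : 0 <= D).
  { unfold D, f22; apply Rplus_le_le_0_compat; apply Rmult_le_pos;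
      first [lra|apply pow2_ge_0]. }
  assert (Dp : 0 < D).
  { destruct D0 as [?|D0]; trivial. rewrite <- D0 in E.
    pose proof (pow2_ge_0 (f12 s r (ge1 l) (ge2 l))). lra. }
  assert (Yp : 0 < sqrt (s * r * wd (ge1 l) (ge2 l) ^ 2) / D).
  { apply Rdiv_lt_0_compat; trivial. now apply sqrt_lt_R0. }
  exists (mkH (f12 s r (ge1 l) (ge2 l) / D) _ Yp), (/ D).
  split; [now apply Rinv_0_lt_compat|].
  destruct (f_div D s r (ge1 l) (ge2 l)) as (F1 & F2 & F3); [lra|].
  replace (/ D * s) with (s / D) by (unfold Rdiv; ring).
  replace (/ D * r) with (r / D) by (unfold Rdiv; ring).
  unfold form_pt; rewrite F1, F2, F3; fold D; cbn [hx hy].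
  split; [|split; [reflexivity|field; lra]].
  transitivity ((f12 s r (ge1 l) (ge2 l) ^ 2
                 + sqrt (s * r * wd (ge1 l) (ge2 l) ^ 2) ^ 2) / D ^ 2); [field; lra|].
  rewrite pow2_sqrt, <- E by lra. field; lra.
Qed.

Lemma Fq_act (g : SL2) (P Q : Bpt) (z : Hpt) :
  Fq (actB g P) (actB g Q) (hx (act g z)) (hy (act g z)) * act_den g z
  = Fq P Q (hx z) (hy z).
Proof.
  assert (Hy : ~ (hy z = 0 /\ 0 = 0)) by (intros [H _]; pose proof (hy_pos z); lra).
  assert (H1 : ~ (hx z = 0 /\ 1 = 0)) by lra.
  (* Every point is a form: its matrix is the sum of [v v^T] over the vectors [(x, 1)] and
     [(y, 0)]. *)
  assert (H : form_pt z 1 1 (mkB _ _ H1) (mkB _ _ Hy))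
    by (unfold form_pt, f11, f12, f22; simpl; repeat split; ring).
  pose proof (act_den_pos g z).
  rewrite (Fq_form _ _ _ _ _ P Q H), (Fq_form _ _ _ _ _ _ _ (form_act g _ _ _ _ _ H)), !wd_act.
  field; lra.
Qed.

(* [h] maps the form [s p p^T + r q q^T] to [t] times itself: for an elliptic [h]
   the form is its fixed point, otherwise a rank one boundary form. *)
Lemma Cstar_form (l : Geod) (h : SL2) :
  Cstar l h ->
  let p := ge1 l in let q := ge2 l in
  exists s r t, 0 <= s /\ 0 <= r /\ 0 < s + r /\ 0 <= t <= 1 /\
    f11 s r (actB h p) (actB h q) = t * f11 s r p q /\
    f12 s r (actB h p) (actB h q) = t * f12 s r p q /\
    f22 s r (actB h p) (actB h q) = t * f22 s r p q.
Proof.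
  intros H p q.
  assert (eig : forall u lam, endpt l u -> lam ^ 2 <= 1 ->
    b1 (actB h u) = lam * b1 u -> b2 (actB h u) = lam * b2 u ->
    exists s r t, 0 <= s /\ 0 <= r /\ 0 < s + r /\ 0 <= t <= 1 /\
    f11 s r (actB h p) (actB h q) = t * f11 s r p q /\
    f12 s r (actB h p) (actB h q) = t * f12 s r p q /\
    f22 s r (actB h p) (actB h q) = t * f22 s r p q).
  { intros u lam Hu Hl E1 E2. pose proof (pow2_ge_0 lam).
    assert (par : forall v, bpeq u v ->
       b1 (actB h v) = lam * b1 v /\ b2 (actB h v) = lam * b2 v).
    { intros v Hv. destruct (wd_parallel u v Hv) as (k & _ & K1 & K2).
      simpl in *; rewrite K1, K2; split.
      - transitivity (k * (ma h * b1 u + mb h * b2 u)); [ring|rewrite E1; ring].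
      - transitivity (k * (mc h * b1 u + md h * b2 u)); [ring|rewrite E2; ring]. }
    destruct Hu as [Hu|Hu]; destruct (par _ Hu) as [K1 K2].
    - exists 1, 0, (lam ^ 2); unfold f11, f12, f22, p.
      rewrite K1, K2; repeat split; try lra; ring.
    - exists 0, 1, (lam ^ 2); unfold f11, f12, f22, q.
      rewrite K1, K2; repeat split; try lra; ring. }
  destruct H as [H|[[H [z [Hz [Hf1 Hf2]]]]|[[[H _] [u [Hu He]]]|[H [u [[lam (Hl & E1 & E2)] He]]]]]].
  - exists 1, 1, 1; rewrite f11_act, f12_act, f22_act.
    destruct H as [(-> & -> & -> & ->)|(-> & -> & -> & ->)]; repeat split; lra.
  - destruct (onG_form _ _ Hz) as (s & r & Hs & Hr & F).
    (* Equal heights force the denominator one, so [h] preserves the form itself and [t = 1]. *)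
    assert (D1 : act_den h z = 1).
    { pose proof (act_den_pos h z) as Dp; pose proof (hy_pos z). simpl in Hf2.
      apply (Rmult_eq_reg_l (hy z)); [|lra].
      rewrite <- Hf2 at 1; field; lra. }
    destruct (form_act h _ _ _ _ _ F) as (G1 & G2 & G3).
    rewrite Hf1, Hf2, D1, !Rdiv_1_r in *. destruct F as (F1 & F2 & F3).
    exists s, r, 1; unfold p, q; repeat split; lra.
  - unfold fixedB, bpeq in Hu. destruct (wd_parallel u (actB h u)) as (k & _ & K1 & K2).
    { unfold wd; lra. }
    apply (eig u k He); trivial.
    (* Trace 2 or -2 makes the characteristic polynomial a square, so the eigenvalue is 1 or -1. *)
    pose proof (eigen_charpoly h u k K1 K2) as T.
    unfold Rabs in H; destruct (Rcase_abs (ma h + md h)).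
    + assert (K : (k + 1) ^ 2 = 0) by (replace (ma h + md h) with (-2) in T; lra).
      replace k with (-1); [lra|].
      apply Rmult_integral in K; destruct K; lra.
    + assert (K : (k - 1) ^ 2 = 0) by (replace (ma h + md h) with 2 in T; lra).
      replace k with 1; [lra|].
      apply Rmult_integral in K; destruct K; lra.
  - apply (eig u lam He); trivial.
    unfold Rabs in Hl; destruct (Rcase_abs lam); nra.
Qed.

(** * Crooked planes *)

(** The left side is the polarised determinant of symmetric matrices, which is invariant under
    [SL2]; on [u u^T] and [v v^T] it is [(u ^ v)^2]. *)
Lemma form_pair (s r s' r' : R) (u v u' v' : Bpt) :
  f11 s r u v * f22 s' r' u' v' + f22 s r u v * f11 s' r' u' v'
  - 2 * (f12 s r u v * f12 s' r' u' v')
  = s * s' * wd u u' ^ 2 + s * r' * wd u v' ^ 2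
    + r * s' * wd v u' ^ 2 + r * r' * wd v v' ^ 2.
Proof. unfold f11, f12, f22, wd; ring. Qed.

Lemma form_smul (g h : SL2) (s r t : R) (p q : Bpt) :
  f11 s r (actB h p) (actB h q) = t * f11 s r p q ->
  f12 s r (actB h p) (actB h q) = t * f12 s r p q ->
  f22 s r (actB h p) (actB h q) = t * f22 s r p q ->
  let k := smul g h in
  f11 s r (actB k p) (actB k q) = t * f11 s r (actB g p) (actB g q) /\
  f12 s r (actB k p) (actB k q) = t * f12 s r (actB g p) (actB g q) /\
  f22 s r (actB k p) (actB k q) = t * f22 s r (actB g p) (actB g q).
Proof.
  intros E1 E2 E3 k.
  assert (T : forall a b c, a * f11 s r (actB h p) (actB h q)
      + b * f12 s r (actB h p) (actB h q) + c * f22 s r (actB h p) (actB h q)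
      = t * (a * f11 s r p q + b * f12 s r p q + c * f22 s r p q))
    by (intros; rewrite E1, E2, E3; ring).
  rewrite (f11_act g), (f12_act g), (f22_act g), <- !T.
  unfold f11, f12, f22, k; simpl; repeat split; ring.
Qed.

Definition all_shrink (l l' : Geod) (g g' : SL2) : Prop :=
  let s x y := wd (actB g x) (actB g' y) ^ 2 < wd x y ^ 2 in
  (s (ge1 l) (ge1 l') /\ s (ge1 l) (ge2 l')) /\ (s (ge2 l) (ge1 l') /\ s (ge2 l) (ge2 l')).

Lemma weighted_lt (s r s' r' a b c d a' b' c' d' : R) :
  0 <= s -> 0 <= r -> 0 < s + r -> 0 <= s' -> 0 <= r' -> 0 < s' + r' ->
  a' < a -> b' < b -> c' < c -> d' < d ->
  s * s' * a' + s * r' * b' + r * s' * c' + r * r' * d'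
  < s * s' * a + s * r' * b + r * s' * c + r * r' * d.
Proof.
  assert (comb : forall s r x y, 0 <= s -> 0 <= r -> 0 < s + r -> 0 < x -> 0 < y ->
                 0 < s * x + r * y).
  { intros s0 r0 x y ? ? ? ? ?. assert (0 <= s0 * x) by nra. assert (0 <= r0 * y) by nra.
    destruct (Req_dec s0 0); [assert (0 < r0 * y) by nra; lra|].
    assert (0 < s0 * x) by nra; lra. }
  intros Hs Hr Hsr Hs' Hr' Hsr' Ha Hb Hc Hd.
  assert (0 < s' * (s * (a - a') + r * (c - c')) + r' * (s * (b - b') + r * (d - d'))).
  { apply comb; trivial; apply comb; lra. }
  lra.
Qed.

Definition crooked_meet (l l' : Geod) (g g' : SL2) : Prop :=
  exists h h' : SL2, Cstar l h /\ Cstar l' h' /\ peq (smul g h) (smul g' h').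

(** Let [k = g h], equal to [g' h'] up to sign. Applying [k] to the forms scaled by [h] and [h']
    preserves their pairing and also gives [t t'] times the pairing of their images under [g] and
    [g']. The inequalities make the latter pairing smaller than the original one, against
    [t t' <= 1]. *)
Lemma all_shrink_not_meet (l l' : Geod) (g g' : SL2) :
  all_shrink l l' g g' -> ~ crooked_meet l l' g g'.
Proof.
  intros [[A B] [C D]] (h & h' & H & H' & E).
  destruct (Cstar_form _ _ H) as (s & r & t & Hs & Hr & Hsr & Ht & F1 & F2 & F3).
  destruct (Cstar_form _ _ H') as (s' & r' & t' & Hs' & Hr' & Hsr' & Ht' & G1 & G2 & G3).
  destruct (form_smul g h _ _ _ _ _ F1 F2 F3) as (K1 & K2 & K3).
  destruct (form_smul g' h' _ _ _ _ _ G1 G2 G3) as (L1 & L2 & L3).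
  set (p := ge1 l) in *; set (q := ge2 l) in *.
  set (p' := ge1 l') in *; set (q' := ge2 l') in *.
  pose proof (form_pair s r s' r' (actB (smul g h) p) (actB (smul g h) q)
                (actB (smul g h) p') (actB (smul g h) q')) as P.
  rewrite !wd_act in P.
  pose proof (form_pair s r s' r' (actB g p) (actB g q) (actB g' p') (actB g' q')) as P'.
  assert (S : f11 s' r' (actB (smul g h) p') (actB (smul g h) q')
              = f11 s' r' (actB (smul g' h') p') (actB (smul g' h') q') /\
              f12 s' r' (actB (smul g h) p') (actB (smul g h) q')
              = f12 s' r' (actB (smul g' h') p') (actB (smul g' h') q') /\
              f22 s' r' (actB (smul g h) p') (actB (smul g h) q')
              = f22 s' r' (actB (smul g' h') p') (actB (smul g' h') q')).
  { apply peq_cases in E; destruct E as [-> | ->]; [auto|].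
    unfold f11, f12, f22; simpl; repeat split; ring. }
  destruct S as (S1 & S2 & S3).
  rewrite S1, S2, S3, K1, K2, K3, L1, L2, L3 in P.
  pose proof (weighted_lt _ _ _ _ _ _ _ _ _ _ _ _ Hs Hr Hsr Hs' Hr' Hsr' A B C D) as W.
  rewrite <- P' in W. rewrite <- P in W.
  match type of W with ?x < _ => set (X := x) in W end.
  assert (W' : X < t * t' * X).
  { eapply Rlt_le_trans; [exact W|]. unfold X; apply Req_le; ring. }
  assert (0 <= X).
  { unfold X; rewrite P'.
    repeat apply Rplus_le_le_0_compat;
      (apply Rmult_le_pos; [now apply Rmult_le_pos|apply pow2_ge_0]). }
  assert (t * t' <= 1) by nra. nra.
Qed.

(** At a common point [z] both forms are the matrix of [z], whose pairing with itself is twice its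
    determinant [y^2]. The images under [g] and [g'] keep this determinant, and positive definite
    matrices of equal determinant pair to at least twice it. *)
Lemma all_shrink_disjoint (l l' : Geod) (g g' : SL2) :
  all_shrink l l' g g' -> geod_disjoint l l'.
Proof.
  intros [[A B] [C D]] z [Hz Hz'].
  destruct (onG_form _ _ Hz) as (s & r & Hs & Hr & F).
  destruct (onG_form _ _ Hz') as (s' & r' & Hs' & Hr' & F').
  assert (W := weighted_lt s r s' r' _ _ _ _ _ _ _ _ ltac:(lra) ltac:(lra) ltac:(lra)
                 ltac:(lra) ltac:(lra) ltac:(lra) A B C D).
  rewrite <- !form_pair in W.
  pose proof (form_pt_det _ _ _ _ _ F) as Y. pose proof (form_pt_det _ _ _ _ _ F') as Y'.
  rewrite <- (wd_act g), <- form_det, (form_act_den g z _ _ _ _ F) in Y.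
  rewrite <- (wd_act g'), <- form_det, (form_act_den g' z _ _ _ _ F') in Y'.
  rewrite (form_act_den g z _ _ _ _ F), (form_act_den g' z _ _ _ _ F') in W.
  destruct F as (F1 & F2 & F3), F' as (F1' & F2' & F3').
  rewrite <- F1, <- F2, <- F3, <- F1', <- F2', <- F3' in W.
  pose proof (act_den_pos g z) as D1. pose proof (act_den_pos g' z) as D2.
  revert W Y Y' D1 D2.
  generalize (act_den g z) (act_den g' z).
  generalize (f11 s r (actB g (ge1 l)) (actB g (ge2 l)))
             (f12 s r (actB g (ge1 l)) (actB g (ge2 l)))
             (f11 s' r' (actB g' (ge1 l')) (actB g' (ge2 l')))
             (f12 s' r' (actB g' (ge1 l')) (actB g' (ge2 l'))).
  generalize (hx z) (hy z). clear.
  intros x y m n m' n' d d' W Y Y' D1 D2.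
  assert (W2 : m * d' + d * m' - 2 * (n * n') < 2 * y ^ 2) by lra.
  apply (Rmult_lt_compat_r (d * d')) in W2; [|nra].
  replace ((m * d' + d * m' - 2 * (n * n')) * (d * d'))
    with ((y ^ 2 + n ^ 2) * d' ^ 2 + (y ^ 2 + n' ^ 2) * d ^ 2 - 2 * (n * n') * (d * d')) in W2
    by (rewrite <- Y at 1; rewrite <- Y'; ring).
  (* The excess of the pairing over [2 y^2], times [d d'], is the sum of these two squares. *)
  pose proof (pow2_ge_0 (n * d' - n' * d)). pose proof (pow2_ge_0 (y * (d - d'))). lra.
Qed.

(** * Construction of common points of crooked planes *)

Definition sone : SL2.
Proof. refine (mkSL2 1 0 0 1 _); ring. Defined.

Lemma smul_sone (g : SL2) : smul g sone = g.
Proof. apply SL2_eq; simpl; ring. Qed.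

Lemma smul_sinv_l (g : SL2) : smul (sinv g) g = sone.
Proof. rewrite <- (smul_sone g) at 2; apply smul_sinvK. Qed.

Lemma act_smul_scaled (f h k : SL2) (x : Bpt) (lam : R) :
  b1 (actB h x) = lam * b1 (actB k x) -> b2 (actB h x) = lam * b2 (actB k x) ->
  b1 (actB (smul f h) x) = lam * b1 (actB (smul f k) x) /\
  b2 (actB (smul f h) x) = lam * b2 (actB (smul f k) x).
Proof.
  simpl; intros E1 E2; split.
  - transitivity (ma f * (ma h * b1 x + mb h * b2 x) + mb f * (mc h * b1 x + md h * b2 x));
      [ring|rewrite E1, E2; ring].
  - transitivity (mc f * (ma h * b1 x + mb h * b2 x) + md f * (mc h * b1 x + md h * b2 x));
      [ring|rewrite E1, E2; ring].
Qed.

Lemma sone_act (x : Bpt) : b1 (actB sone x) = b1 x /\ b2 (actB sone x) = b2 x.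
Proof. simpl; split; ring. Qed.

Lemma wd_smul_sinv (g g' : SL2) (x y : Bpt) :
  wd (actB g x) (actB g' y) = wd x (actB (smul (sinv g) g') y).
Proof.
  rewrite <- (smul_sinvKV g g') at 1.
  transitivity (wd (actB g x) (actB g (actB (smul (sinv g) g') y)));
    [unfold wd; simpl; ring|apply wd_act].
Qed.

Lemma trace_wd (h : SL2) (p q : Bpt) :
  (ma h + md h) * wd p q = wd (actB h p) q + wd p (actB h q).
Proof. unfold wd; simpl; ring. Qed.

Lemma fixed_of_form (h : SL2) (z : Hpt) (s r : R) (u v : Bpt) :
  form_pt z s r u v ->
  f12 s r (actB h u) (actB h v) = f12 s r u v ->
  f22 s r (actB h u) (actB h v) = f22 s r u v -> hpeq (act h z) z.
Proof.
  intros F E2 E3.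
  assert (D : act_den h z = 1).
  { rewrite <- (form_act_den h z s r u v F), E3; symmetry; apply F. }
  destruct (form_act h z s r u v F) as (_ & G2 & _). rewrite D, !Rdiv_1_r in G2.
  split; [rewrite G2, E2; symmetry; apply F|simpl; rewrite D; field].
Qed.

Lemma sinv_eigen (g : SL2) (y : Bpt) (nu : R) :
  nu <> 0 -> b1 (actB g y) = nu * b1 y -> b2 (actB g y) = nu * b2 y ->
  b1 (actB (sinv g) y) = / nu * b1 y /\ b2 (actB (sinv g) y) = / nu * b2 y.
Proof.
  simpl; intros H N1 N2; pose proof (mdet g) as D; split.
  - transitivity (/ nu * (md g * (nu * b1 y) - mb g * (nu * b2 y))); [field; exact H|].
    rewrite <- N1, <- N2.
    transitivity (/ nu * ((ma g * md g - mb g * mc g) * b1 y)); [ring|rewrite D; ring].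
  - transitivity (/ nu * (ma g * (nu * b2 y) - mc g * (nu * b1 y))); [field; exact H|].
    rewrite <- N1, <- N2.
    transitivity (/ nu * ((ma g * md g - mb g * mc g) * b2 y)); [ring|rewrite D; ring].
Qed.

(* The two lines share an endpoint [y] whose images are distinct: a rotation about
   a point of [l'] far enough towards [y] brings [y] to a short vector. *)
Lemma meet_of_shared_end (l l' : Geod) (g g' : SL2) :
  endpt l (ge1 l') -> wd (actB g (ge1 l')) (actB g' (ge1 l')) <> 0 ->
  crooked_meet l l' g g'.
Proof.
  set (y := ge1 l'); set (y' := ge2 l'); intros Hy Hw.
  pose proof (ge_wd l') as W; fold y y' in W.
  set (w := actB (smul (sinv g') g) y).
  (* Coordinates of [w] in the basis [y], [y']; [be] is nonzero because the images of [y] are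
     distinct. *)
  set (al := wd w y' / wd y y'); set (be := wd y w / wd y y').
  assert (Hbe : be <> 0).
  { unfold be, w. rewrite <- wd_smul_sinv, wd_anti.
    unfold Rdiv; apply Rmult_integral_contrapositive; split;
      [lra|now apply Rinv_neq_0_compat]. }
  assert (Ew1 : b1 w = al * b1 y + be * b1 y')
    by (unfold al, be, wd in *; field; exact W).
  assert (Ew2 : b2 w = al * b2 y + be * b2 y')
    by (unfold al, be, wd in *; field; exact W).
  (* In this basis [h'] will be [(lam al, - lam / be; lam be, lam al)], and this [lam] makes its
     determinant one. *)
  set (lam := / sqrt (1 + al ^ 2)).
  assert (Hal : 0 < 1 + al ^ 2) by (pose proof (pow2_ge_0 al); lra).
  assert (Hl : lam ^ 2 * (1 + al ^ 2) = 1).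
  { unfold lam; rewrite <- (pow2_sqrt (1 + al ^ 2)) at 2 by lra.
    field. pose proof (sqrt_lt_R0 _ Hal); lra. }
  assert (Hl0 : 0 < lam) by (apply Rinv_0_lt_compat, sqrt_lt_R0, Hal).
  destruct (SL2_of_images y y' (lam * b1 w) (lam * b2 w)
     (- (lam / be) * b1 y + lam * al * b1 y') (- (lam / be) * b2 y + lam * al * b2 y') W)
    as (h' & [U1 U2] & [V1 V2]).
  { transitivity (lam ^ 2 * (1 + al ^ 2) * wd y y'); [|rewrite Hl; ring].
    rewrite Ew1, Ew2; unfold wd; field; exact Hbe. }
  (* This [h] sends [y] to [lam y], since [h' y] is [lam] times [g'^-1 g y]. *)
  set (h := smul (sinv g) (smul g' h')).
  assert (E : smul (smul (sinv g) g') (smul (sinv g') g) = sone).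
  { rewrite <- smulA, smul_sinvKV; apply smul_sinv_l. }
  destruct (act_smul_scaled (smul (sinv g) g') h' _ y lam U1 U2) as [H1 H2].
  destruct (sone_act y) as [I1 I2].
  rewrite E, <- smulA in H1, H2; fold h in H1, H2; rewrite I1 in H1; rewrite I2 in H2.
  exists h, h'; split; [|split].
  - apply (eigen_Cstar l h y lam Hy); trivial.
    rewrite Rabs_pos_eq by lra. nra.
  - right; left; split.
    + assert (T : ma h' + md h' = 2 * (lam * al)).
      { apply (Rmult_eq_reg_r (wd y y')); trivial. rewrite trace_wd.
        unfold wd; rewrite U1, U2, V1, V2, Ew1, Ew2; ring. }
      unfold elliptic; rewrite T. apply Rabs_def1; nra.
    (* The form with weights 1 and [be^2] on [y] and [y'] is invariant under [h']. *)
    + destruct (geod_pt l' 1 (be ^ 2)) as (z & k & _ & F); [lra|now apply sqr_pos|].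
      exists z; split; [eapply form_onG, F|].
      apply (fixed_of_form h' z _ _ _ _ F); fold y y'.
      * unfold f12; rewrite U1, U2, V1, V2, Ew1, Ew2.
        transitivity (lam ^ 2 * (1 + al ^ 2) * (k * 1 * (b1 y * b2 y) + k * be ^ 2 * (b1 y' * b2 y')));
          [field; exact Hbe|rewrite Hl; ring].
      * unfold f22; rewrite U2, V2, Ew2.
        transitivity (lam ^ 2 * (1 + al ^ 2) * (k * 1 * b2 y ^ 2 + k * be ^ 2 * b2 y' ^ 2));
          [field; exact Hbe|rewrite Hl; ring].
  - apply peq_cases; left; unfold h; apply smul_sinvKV.
Qed.

(** If [x] and [y] are distinct boundary points, matrices with eigenvectors [x] and [y] give the
    common point. If they coincide, either their images differ, or [y] is an eigenvector of [gam],
    and [gam] or its inverse does not expand it. *)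
Lemma meet_of_not_shrink (l l' : Geod) (g g' : SL2) :
  wd (ge1 l) (ge1 l') ^ 2 <= wd (actB g (ge1 l)) (actB g' (ge1 l')) ^ 2 ->
  crooked_meet l l' g g'.
Proof.
  set (x := ge1 l); set (y := ge1 l'); intros H.
  set (gam := smul (sinv g) g').
  assert (Hx : endpt l x) by (left; unfold bpeq, x; ring).
  assert (Hy : endpt l' y) by (left; unfold bpeq, y; ring).
  assert (Eg : smul g gam = g') by apply smul_sinvKV.
  destruct (Req_dec (wd x y) 0) as [Z|NZ].
  - assert (Hyl : endpt l y) by (left; unfold bpeq, x, y, wd in *; lra).
    destruct (Req_dec (wd (actB g y) (actB g' y)) 0) as [Z'|NZ'];
      [|now apply meet_of_shared_end].
    rewrite wd_smul_sinv in Z'. fold gam in Z'.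
    destruct (wd_parallel _ _ Z') as (nu & Hnu & N1 & N2).
    destruct (Rle_lt_dec (Rabs nu) 1) as [L|L].
    + exists gam, sone; split; [|split].
      * exact (eigen_Cstar l gam y nu Hyl L N1 N2).
      * left; left; simpl; auto.
      * apply peq_cases; left; now rewrite smul_sone.
    + exists sone, (sinv gam); split; [|split].
      * left; left; simpl; auto.
      * apply (eigen_Cstar l' (sinv gam) y (/ nu) Hy).
        { rewrite Rabs_inv. rewrite <- Rinv_1. apply Rinv_le_contravar; lra. }
        { now apply sinv_eigen. }
        { now apply sinv_eigen. }
      * apply peq_cases; left; rewrite smul_sone, <- Eg; symmetry; apply smul_K_sinv.
  - set (om := wd (actB g x) (actB g' y)) in *.
    pose proof (sqr_pos _ NZ) as P.
    assert (NO : om <> 0) by (intros ->; lra).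
    (* This factor gives determinant one to the matrix [h] with [h x = lam x] and [h y = gam y];
       then [g'^-1 g h] fixes the vector [y]. *)
    set (lam := wd x y / om).
    assert (Hl : Rabs lam <= 1).
    { assert (lam ^ 2 <= 1).
      { apply (Rmult_le_reg_r (om ^ 2)); [now apply sqr_pos|].
        replace (lam ^ 2 * om ^ 2) with (wd x y ^ 2) by (unfold lam; field; trivial). lra. }
      apply Rabs_le; nra. }
    destruct (SL2_of_images x y (lam * b1 x) (lam * b2 x)
                (b1 (actB gam y)) (b2 (actB gam y)) NZ) as (h & [U1 U2] & [V1 V2]).
    { transitivity (lam * wd x (actB gam y)); [unfold wd; ring|].
      unfold gam; rewrite <- wd_smul_sinv; unfold lam; fold om; field; exact NO. }
    exists h, (smul (sinv g') (smul g h)); split; [|split].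
    + exact (eigen_Cstar l h x lam Hx Hl U1 U2).
    + destruct (act_smul_scaled (smul (sinv g') g) h gam y 1) as [E1 E2];
        [lra|lra|].
      rewrite <- !smulA, Eg in E1, E2.
      replace (smul (sinv g') g') with sone in E1, E2
        by (symmetry; apply smul_sinv_l).
      destruct (sone_act y) as [I1 I2]; rewrite I1 in E1; rewrite I2 in E2.
      apply (eigen_Cstar l' _ y 1 Hy); [rewrite Rabs_R1; lra|exact E1|exact E2].
    + apply peq_cases; left; symmetry; apply smul_sinvKV.
Qed.

Lemma crooked_meet_gswap_l (l l' : Geod) (g g' : SL2) :
  crooked_meet (gswap l) l' g g' -> crooked_meet l l' g g'.
Proof. intros (h & h' & H & H'); exists h, h'; split; trivial; now apply Cstar_gswap. Qed.

Lemma crooked_meet_gswap_r (l l' : Geod) (g g' : SL2) :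
  crooked_meet l (gswap l') g g' -> crooked_meet l l' g g'.
Proof.
  intros (h & h' & H & H' & E); exists h, h'; repeat split; trivial; now apply Cstar_gswap.
Qed.

Lemma not_meet_all_shrink (l l' : Geod) (g g' : SL2) :
  ~ crooked_meet l l' g g' -> all_shrink l l' g g'.
Proof.
  intros C; repeat split; apply Rnot_le_lt; intros H; apply C.
  - now apply meet_of_not_shrink.
  - now apply crooked_meet_gswap_r, meet_of_not_shrink.
  - now apply crooked_meet_gswap_l, meet_of_not_shrink.
  - now apply crooked_meet_gswap_l, crooked_meet_gswap_r, meet_of_not_shrink.
Qed.

(** * Factorisation of 2 x 2 matrices *)

(** The equation between [x] and [y] says that the two matrices have equal determinant. Both factors
    are a hyperbolic rotation [(c s; s c)], with eigenvalue [al] on [(1, 1)] and [1 / al] on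
    [(1, -1)]. So the sum of the entries must be multiplied by [al^2], which determines [al];
    [a + d - b - k] must be divided by [al^2], which follows from the equal determinants; [a - d]
    and [b - k] do not change. *)
Lemma product_decomposition_scaled (a b k d x y : R) :
  0 < a -> 0 < b -> 0 < k -> 0 < d -> 0 < x -> 0 < y ->
  x ^ 2 - (a + d) * x = y ^ 2 - (b + k) * y -> x + y < a + d -> x + y < b + k ->
  exists c s, 1 < c /\ 0 < s /\ c ^ 2 - s ^ 2 = 1 /\
    let e := a - x in let f := b - y in let g := k - y in let h := d - x in
    a = c * c * e + c * s * f + s * c * g + s * s * h /\
    b = c * c * f + c * s * e + s * s * g + s * c * h /\
    k = c * c * g + c * s * h + s * c * e + s * s * f /\
    d = c * c * h + c * s * g + s * c * f + s * s * e.
Proof.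
  intros Ha Hb Hk Hd Hx Hy E H1 H2.
  set (P := a + b + k + d); set (P' := P - 2 * x - 2 * y).
  assert (HP : 0 < P') by (unfold P', P; lra).
  assert (HPP : P' < P) by (unfold P'; lra).
  set (rho := P / P').
  assert (Hr : 1 < rho).
  { unfold rho; apply (Rmult_lt_reg_r P'); trivial.
    replace (P / P' * P') with P by (field; lra); lra. }
  set (al := sqrt rho).
  assert (Hal : 1 < al) by (unfold al; rewrite <- sqrt_1; apply sqrt_lt_1; lra).
  assert (Hal2 : al ^ 2 = rho) by (apply pow2_sqrt; lra).
  assert (Hi : / al < 1) by (rewrite <- Rinv_1; apply Rinv_lt_contravar; lra).
  assert (EP : al ^ 2 * P' = P) by (rewrite Hal2; unfold rho; field; lra).
  assert (EQ : (a + d - b - k) * al ^ 2 = a + d - b - k - 2 * (x - y)).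
  { apply (Rmult_eq_reg_r P'); [|lra].
    transitivity ((a + d - b - k) * (al ^ 2 * P')); [ring|rewrite EP].
    transitivity ((a + d - b - k) * P + 4 * ((x ^ 2 - (a + d) * x) - (y ^ 2 - (b + k) * y)));
      [rewrite E; ring|unfold P', P; ring]. }
  exists ((al + / al) / 2), ((al - / al) / 2).
  assert (Hal0 : al <> 0) by lra.
  split; [|split; [lra|split; [field; trivial|]]].
  - assert (0 < (al - 1) ^ 2 / al) by (apply Rdiv_lt_0_compat; [apply sqr_pos|]; lra).
    assert (al + / al - 2 = (al - 1) ^ 2 / al) by (field; trivial). lra.
  - assert (EQ' : (a + d - b - k - 2 * (x - y)) * (/ al) ^ 2 = a + d - b - k)
      by (rewrite <- EQ; field; trivial).
    assert (I : al * / al = 1) by (field; trivial).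
    unfold P' in EP; unfold P in EP.
    cbv zeta; set (be := / al) in *; clearbody be.
    repeat split.
    + transitivity ((al ^ 2 * (a + b + k + d - 2 * x - 2 * y)
        + (a + d - b - k - 2 * (x - y)) * be ^ 2 + 2 * (al * be) * (a - d)) / 4);
        [rewrite EP, EQ', I|]; field.
    + transitivity ((al ^ 2 * (a + b + k + d - 2 * x - 2 * y)
        - (a + d - b - k - 2 * (x - y)) * be ^ 2 + 2 * (al * be) * (b - k)) / 4);
        [rewrite EP, EQ', I|]; field.
    + transitivity ((al ^ 2 * (a + b + k + d - 2 * x - 2 * y)
        - (a + d - b - k - 2 * (x - y)) * be ^ 2 + 2 * (al * be) * (k - b)) / 4);
        [rewrite EP, EQ', I|]; field.
    + transitivity ((al ^ 2 * (a + b + k + d - 2 * x - 2 * y)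
        + (a + d - b - k - 2 * (x - y)) * be ^ 2 + 2 * (al * be) * (d - a)) / 4);
        [rewrite EP, EQ', I|]; field.
Qed.

(* [(a b; k d) = (c nu; mu c) (e f; g h) (c mu'; nu' c)], with positive factors
   of determinant one. *)
Definition product_decomposition (a b k d e f g h : R) : Prop :=
  exists c mu nu mu' nu', 1 < c /\ 0 < mu /\ 0 < nu /\ 0 < mu' /\ 0 < nu' /\
    c ^ 2 - mu * nu = 1 /\ c ^ 2 - mu' * nu' = 1 /\
    a = c * c * e + c * nu' * f + nu * c * g + nu * nu' * h /\
    b = c * c * f + c * mu' * e + nu * mu' * g + nu * c * h /\
    k = c * c * g + c * nu' * h + mu * c * e + mu * nu' * f /\
    d = c * c * h + c * mu' * g + mu * c * f + mu * mu' * e.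

(* Row and column scalings, which preserve the shape of the factors, make the
   decrements along each diagonal of the matrix equal. *)
Lemma product_decomposition_of_lt (a b k d e f g h : R) :
  0 < a -> 0 < b -> 0 < k -> 0 < d -> e < a -> f < b -> g < k -> h < d ->
  a * d - e * h = b * k - f * g ->
  sqrt ((a - e) * (d - h)) * sqrt ((b - f) * (k - g)) < a * d - e * h ->
  product_decomposition a b k d e f g h.
Proof.
  intros Ha Hb Hk Hd He Hf Hg Hh E M.
  assert (Px : 0 < (a - e) * (d - h)) by (apply Rmult_lt_0_compat; lra).
  assert (Py : 0 < (b - f) * (k - g)) by (apply Rmult_lt_0_compat; lra).
  pose proof (sqrt_lt_R0 _ Px) as Hx. pose proof (sqrt_lt_R0 _ Py) as Hy.
  pose proof (pow2_sqrt _ (Rlt_le _ _ Px)) as Ex.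
  pose proof (pow2_sqrt _ (Rlt_le _ _ Py)) as Ey.
  set (x := sqrt ((a - e) * (d - h))) in *; set (y := sqrt ((b - f) * (k - g))) in *.
  clearbody x y.
  (* [x] and [y] are the geometric means of the decrements along the two diagonals; passing to the
     entries [a s], [d / s], [b t], [k / t] makes the decrements equal to them. *)
  set (s := x / (a - e)); set (t := y / (b - f)).
  assert (Hs : 0 < s) by (apply Rdiv_lt_0_compat; lra).
  assert (Ht : 0 < t) by (apply Rdiv_lt_0_compat; lra).
  assert (E1 : e * s = a * s - x) by (unfold s; field; lra).
  assert (E2 : f * t = b * t - y) by (unfold t; field; lra).
  assert (E3 : h / s = d / s - x).
  { assert ((d - h) / s = x); [|unfold Rdiv in *; lra].
    unfold s; transitivity ((a - e) * (d - h) / x); [field; lra|rewrite <- Ex; field; lra]. }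
  assert (E4 : g / t = k / t - y).
  { assert ((k - g) / t = y); [|unfold Rdiv in *; lra].
    unfold t; transitivity ((b - f) * (k - g) / y); [field; lra|rewrite <- Ey; field; lra]. }
  (* Divided by [x] and by [y], these turn [x y < a d - e h] into the two bounds on [x + y] needed
     for the scaled matrix. *)
  assert (M1 : a * d - e * h = x * (a * s + d / s - x)).
  { transitivity (a * s * (d / s) - e * s * (h / s)); [field; lra|rewrite E1, E3; ring]. }
  assert (M2 : b * k - f * g = y * (b * t + k / t - y)).
  { transitivity (b * t * (k / t) - f * t * (g / t)); [field; lra|rewrite E2, E4; ring]. }
  destruct (product_decomposition_scaled (a * s) (b * t) (k / t) (d / s) x y)
    as (c & w & Hc & Hw & Hd1 & R1 & R2 & R3 & R4);
    try first [assumption | apply Rmult_lt_0_compat; assumption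
              | apply Rdiv_lt_0_compat; assumption].
  - lra.
  - apply (Rplus_lt_reg_r (- x)), (Rmult_lt_reg_l x); lra.
  - apply (Rplus_lt_reg_r (- y)), (Rmult_lt_reg_l y); lra.
  - rewrite <- E1, <- E2, <- E3, <- E4 in R1, R2, R3, R4.
    (* Undoing the scaling moves the factors [s t] and [s / t] between off-diagonal entries, whose
       product stays [w^2]. *)
    exists c, (w * (s * t)), (w / (s * t)), (w * (s / t)), (w * (t / s)).
    assert (0 < s * t) by now apply Rmult_lt_0_compat.
    assert (0 < s / t) by now apply Rdiv_lt_0_compat.
    assert (0 < t / s) by now apply Rdiv_lt_0_compat.
    assert (0 < w / (s * t)) by now apply Rdiv_lt_0_compat.
    repeat split; trivial; try (apply Rmult_lt_0_compat; assumption);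
      try (rewrite <- Hd1; field; split; lra).
    + apply (Rmult_eq_reg_r s); [|lra]. rewrite R1; field; lra.
    + apply (Rmult_eq_reg_r t); [|lra]. rewrite R2; field; lra.
    + apply (Rmult_eq_reg_r (/ t)); [|apply Rinv_neq_0_compat; lra].
      change (k * / t) with (k / t); rewrite R3; field; lra.
    + apply (Rmult_eq_reg_r (/ s)); [|apply Rinv_neq_0_compat; lra].
      change (d * / s) with (d / s); rewrite R4; field; lra.
Qed.

(* The criterion of the previous lemma holds for [(e f; g h)] or for its opposite:
   [(a^2 - e^2) (d^2 - h^2)] and [(b^2 - f^2) (k^2 - g^2)] are at most [(a d - e h)^2],
   so if both criteria fail all these are equal and [a d = b k]. *)
Lemma product_decomposition_up_to_sign (a b k d e f g h : R) :
  Rabs e < a -> Rabs f < b -> Rabs g < k -> Rabs h < d ->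
  a * d - b * k = e * h - f * g -> a * d - b * k <> 0 ->
  product_decomposition a b k d e f g h \/
  product_decomposition a b k d (- e) (- f) (- g) (- h).
Proof.
  intros He Hf Hg Hh E N.
  apply Rabs_def2 in He, Hf, Hg, Hh.
  set (M := a * d - e * h).
  assert (EM : M = b * k - f * g) by (unfold M; lra).
  assert (Px : 0 < (a - e) * (d - h)) by (apply Rmult_lt_0_compat; lra).
  assert (Py : 0 < (b - f) * (k - g)) by (apply Rmult_lt_0_compat; lra).
  assert (Px' : 0 < (a - - e) * (d - - h)) by (apply Rmult_lt_0_compat; lra).
  assert (Py' : 0 < (b - - f) * (k - - g)) by (apply Rmult_lt_0_compat; lra).
  destruct (Rlt_le_dec (sqrt ((a - e) * (d - h)) * sqrt ((b - f) * (k - g))) M) as [L|L].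
  { left; apply product_decomposition_of_lt; unfold M in *; lra. }
  destruct (Rlt_le_dec (sqrt ((a - - e) * (d - - h)) * sqrt ((b - - f) * (k - - g))) M)
    as [L'|L'].
  { right; apply product_decomposition_of_lt; unfold M in *; lra. }
  exfalso.
  assert (HM : 0 < M) by (unfold M; nra).
  rewrite <- sqrt_mult in L, L' by lra.
  assert (Q : M ^ 2 <= (a - e) * (d - h) * ((b - f) * (k - g))).
  { rewrite <- (pow2_sqrt (_ * _)) by nra. apply pow_incr; lra. }
  assert (Q' : M ^ 2 <= (a - - e) * (d - - h) * ((b - - f) * (k - - g))).
  { rewrite <- (pow2_sqrt (_ * _)) by nra. apply pow_incr; lra. }
  assert (S : (a - e) * (d - h) * ((a - - e) * (d - - h)) = M ^ 2 - (a * h - d * e) ^ 2)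
    by (unfold M; ring).
  assert (S' : (b - f) * (k - g) * ((b - - f) * (k - - g)) = M ^ 2 - (b * g - k * f) ^ 2)
    by (rewrite EM; ring).
  pose proof (pow2_ge_0 (a * h - d * e)). pose proof (pow2_ge_0 (b * g - k * f)).
  (* The two sides differ by [4 (a d - b k)]. *)
  assert (N' : (a - e) * (d - h) + (a - - e) * (d - - h)
               <> (b - f) * (k - g) + (b - - f) * (k - - g)) by (unfold M in *; lra).
  set (X := (a - e) * (d - h)) in *; set (Y := (b - f) * (k - g)) in *.
  set (X' := (a - - e) * (d - - h)) in *; set (Y' := (b - - f) * (k - - g)) in *.
  assert (B1 : X * X' <= M ^ 2) by lra. assert (B2 : Y * Y' <= M ^ 2) by lra.
  clearbody X Y X' Y'. apply N'.
  assert (HM2 : 0 < M ^ 2) by (apply sqr_pos; lra).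
  set (m := M ^ 2) in *; clearbody m.
  (* Since [X X'] and [Y Y'] are at most [m], and [X Y] and [X' Y'] at least [m], it follows that
     [X' = Y] and [X = Y']. *)
  assert (X' <= Y) by (apply (Rmult_le_reg_l X); lra).
  assert (Y' <= X) by (apply (Rmult_le_reg_l Y); lra).
  assert (X <= Y') by (apply (Rmult_le_reg_l X'); lra).
  assert (Y <= X') by (apply (Rmult_le_reg_l Y'); lra).
  lra.
Qed.

(** * Stem quadrants *)

(* [sg] is the sign, on the line with endpoints [x], [y], of the equation [Fq u v] of a
   line disjoint from it; the two lines may share an endpoint. *)
Definition faces (sg : R) (u v x y : Bpt) : Prop :=
  0 <= sg * (wd u x * wd v x) /\ 0 <= sg * (wd u y * wd v y) /\
  0 < sg * (wd u x * wd v x) + sg * (wd u y * wd v y).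

Lemma nonneg_of_cone (X Y : R) :
  (forall s r, 0 < s -> 0 < r -> 0 < s * X + r * Y) -> 0 <= X /\ 0 <= Y /\ 0 < X + Y.
Proof.
  intros H. pose proof (H 1 1 ltac:(lra) ltac:(lra)). repeat split; [| |lra].
  - apply Rnot_lt_le; intros N.
    (* With these weights the combination is [X] times a number that is at least one. *)
    pose proof (H (Rabs Y + 1) (- X) ltac:(pose proof (Rabs_pos Y); lra) ltac:(lra)).
    pose proof (Rle_abs Y). nra.
  - apply Rnot_lt_le; intros N.
    pose proof (H (- Y) (Rabs X + 1) ltac:(lra) ltac:(pose proof (Rabs_pos X); lra)).
    pose proof (Rle_abs X). nra.
Qed.

(** On the points of [l'], given by all positive weights, the equation of [l] is [s X + r Y] up to a
    positive factor. As it never vanishes there, [X] and [Y] have a common weak sign and are not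
    both zero. *)
Lemma disjoint_faces (l l' : Geod) :
  geod_disjoint l l' ->
  exists sg, (sg = 1 \/ sg = -1) /\ faces sg (ge1 l) (ge2 l) (ge1 l') (ge2 l').
Proof.
  intros Hd; unfold faces.
  set (X := wd (ge1 l) (ge1 l') * wd (ge2 l) (ge1 l')).
  set (Y := wd (ge1 l) (ge2 l') * wd (ge2 l) (ge2 l')).
  assert (NZ : forall s r, 0 < s -> 0 < r -> s * X + r * Y <> 0).
  { intros s r Hs Hr E. destruct (geod_pt l' s r Hs Hr) as (z & k & Hk & F).
    apply (Hd z); split; [|eapply form_onG, F].
    unfold onG; rewrite (Fq_form _ _ _ _ _ _ _ F); fold X Y.
    transitivity (k * (s * X + r * Y)); [ring|rewrite E; ring]. }
  pose proof (NZ 1 1 ltac:(lra) ltac:(lra)) as N1.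
  assert (S : 0 <= X * Y).
  { apply Rnot_lt_le; intros N.
    destruct (Rlt_le_dec 0 X); destruct (Rlt_le_dec 0 Y); try nra.
    - assert (Y < 0) by nra. apply (NZ (- Y) X); lra.
    - assert (X < 0) by nra. apply (NZ Y (- X)); lra. }
  destruct (Rlt_le_dec 0 (X + Y)).
  - exists 1; split; [auto|]. repeat split; nra.
  - exists (-1); split; [auto|]. assert (X + Y < 0) by lra. repeat split; nra.
Qed.

(** With the sign [sg] on the second row and [sg'] on the second column of the matrix of pairings,
    entries of one row or one column never have opposite signs. Some column has no zero entry, and
    its sign spreads along the rows. *)
Lemma faces_sym (sg sg' : R) (p q p' q' : Bpt) :
  (sg = 1 \/ sg = -1) -> (sg' = 1 \/ sg' = -1) ->
  faces sg p q p' q' -> faces sg' p' q' p q ->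
  exists ep, (ep = 1 \/ ep = -1) /\
    0 <= ep * wd p p' /\ 0 <= ep * (sg' * wd p q') /\
    0 <= ep * (sg * wd q p') /\ 0 <= ep * (sg * sg' * wd q q').
Proof.
  unfold faces; rewrite (wd_anti p p'), (wd_anti q p'), (wd_anti p q'), (wd_anti q q').
  generalize (wd p p') (wd p q') (wd q p') (wd q q').
  intros u v s t Hs Hs' (A & B & C) (A' & B' & C').
  assert (C1 : 0 < u * (sg * s) + (sg' * v) * (sg * sg' * t)).
  { replace ((sg' * v) * (sg * sg' * t)) with ((sg' * sg') * (sg * (v * t))) by ring.
    destruct Hs' as [-> | ->]; lra. }
  assert (A1 : 0 <= u * (sg * s)) by lra.
  assert (B1 : 0 <= (sg' * v) * (sg * sg' * t))
    by (destruct Hs' as [-> | ->]; lra).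
  assert (A2 : 0 <= u * (sg' * v)) by lra.
  assert (B2 : 0 <= (sg * s) * (sg * sg' * t))
    by (destruct Hs as [-> | ->]; lra).
  generalize dependent (sg * sg' * t). generalize dependent (sg' * v).
  generalize dependent (sg * s). clear. intros s A1 v A2 t C1 B1 B2.
  assert (key : forall u v s t, 0 < u -> 0 < u * s -> 0 <= u * v -> 0 <= s * t ->
                0 <= u /\ 0 <= v /\ 0 <= s /\ 0 <= t).
  { clear; intros u v s t Hu H1 H2 H3.
    assert (0 < s) by (apply (Rmult_lt_reg_l u); lra).
    repeat split; [lra|apply (Rmult_le_reg_l u)|lra|apply (Rmult_le_reg_l s)]; lra. }
  assert (Hc : 0 < u * s \/ 0 < v * t) by (destruct (Rlt_le_dec 0 (u * s)); [left|right]; lra).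
  destruct Hc as [H|H].
  - destruct (Rlt_le_dec 0 u).
    + exists 1; split; [auto|]. destruct (key u v s t) as (?&?&?&?); lra.
    + exists (-1); split; [auto|].
      assert (u <> 0) by (intros ->; lra).
      destruct (key (- u) (- v) (- s) (- t)) as (?&?&?&?); lra.
  - destruct (Rlt_le_dec 0 v).
    + exists 1; split; [auto|]. destruct (key v u t s) as (?&?&?&?); lra.
    + exists (-1); split; [auto|].
      assert (v <> 0) by (intros ->; lra).
      destruct (key (- v) (- u) (- t) (- s)) as (?&?&?&?); lra.
Qed.

Lemma faces_pos (l l' : Geod) (sg : R) (u v : Bpt) (z : Hpt) (s r : R) :
  faces sg u v (ge1 l') (ge2 l') -> 0 < s -> 0 < r ->
  form_pt z s r (ge1 l') (ge2 l') -> 0 < sg * Fq u v (hx z) (hy z).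
Proof.
  intros (A & B & C) Hs Hr F; rewrite (Fq_form _ _ _ _ _ _ _ F).
  set (X := sg * (wd u (ge1 l') * wd v (ge1 l'))) in *.
  set (Y := sg * (wd u (ge2 l') * wd v (ge2 l'))) in *.
  replace (sg * _) with (s * X + r * Y) by (unfold X, Y; ring).
  destruct A as [A|A]; [|rewrite <- A in *]; destruct B as [B|B]; nra.
Qed.

Lemma opposite_sign_iff (sg x y : R) : 0 < sg * y -> x * y < 0 <-> sg * x < 0.
Proof.
  intros P. assert (S : 0 < sg ^ 2) by (apply sqr_pos; intros ->; lra).
  assert (E : sg * x * (sg * y) = sg ^ 2 * (x * y)) by ring.
  split; intros H; apply Rnot_le_lt; intros Q.
  - assert (0 <= sg * x * (sg * y)) by (apply Rmult_le_pos; lra).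
    assert (0 < sg ^ 2 * - (x * y)) by (apply Rmult_lt_0_compat; lra). lra.
  - assert (0 < - (sg * x) * (sg * y)) by (apply Rmult_lt_0_compat; lra).
    assert (0 <= sg ^ 2 * (x * y)) by (apply Rmult_le_pos; lra). lra.
Qed.

(** The equation of [l] has the constant sign [sg] on [l'], so a single point of [l'] decides. *)
Lemma posside_iff (l l' : Geod) (sg : R) (z : Hpt) :
  faces sg (ge1 l) (ge2 l) (ge1 l') (ge2 l') ->
  posside l l' z <-> sg * Fq (ge1 l) (ge2 l) (hx z) (hy z) < 0.
Proof.
  intros F; unfold posside, opp_side; split.
  - intros H. destruct (geod_pt l' 1 1) as (w & k & Hk & Fw); [lra|lra|].
    pose proof (fun H => faces_pos l l' sg _ _ w _ _ F H H Fw) as P.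
    specialize (P ltac:(lra)).
    apply (opposite_sign_iff _ _ _ P), H. eapply form_onG, Fw.
  - intros H w Hw. destruct (onG_form _ _ Hw) as (s & r & Hs & Hr & Fw).
    apply (opposite_sign_iff sg); [|exact H]. exact (faces_pos l l' sg _ _ w _ _ F Hs Hr Fw).
Qed.

(** The two sides agree modulo the equations of the two lines; this turns perpendicularity of the
    normals into a relation between endpoint pairings. *)
Lemma grad_product (u v p q : Bpt) (x y : R) :
  Fq u v x y = 0 -> Fq p q x y = 0 ->
  y ^ 2 * (gradF1 u v x y * gradF1 p q x y + gradF2 u v x y * gradF2 p q x y)
  = Fq u p x y * Fq v q x y + Fq u q x y * Fq v p x y.
Proof.
  intros E E'.
  transitivity (Fq u p x y * Fq v q x y + Fq u q x y * Fq v p x y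
    - Fq u v x y * ((x * b2 p - b1 p) * (x * b2 q - b1 q) - y ^ 2 * b2 p * b2 q)
    - Fq p q x y * ((x * b2 u - b1 u) * (x * b2 v - b1 v) - y ^ 2 * b2 u * b2 v)).
  - unfold gradF1, gradF2, Fq; ring.
  - rewrite E, E'; ring.
Qed.

Lemma wd_coords (u p q : Bpt) :
  wd p q <> 0 ->
  b1 u = wd u q / wd p q * b1 p + wd p u / wd p q * b1 q /\
  b2 u = wd u q / wd p q * b2 p + wd p u / wd p q * b2 q.
Proof. unfold wd; intros H; split; field; exact H. Qed.

Lemma wd_eigen (h : SL2) (r a p q : Bpt) (lr la : R) :
  b1 (actB h r) = lr * b1 r -> b2 (actB h r) = lr * b2 r ->
  b1 (actB h a) = la * b1 a -> b2 (actB h a) = la * b2 a -> wd r a <> 0 ->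
  wd (actB h p) q * wd r a = lr * (wd p a * wd r q) + la * (wd r p * wd a q).
Proof.
  intros R1 R2 A1 A2 N.
  destruct (wd_coords p r a N) as [P1 P2].
  assert (E1 : b1 (actB h p) = wd p a / wd r a * b1 (actB h r) + wd r p / wd r a * b1 (actB h a)).
  { simpl; rewrite P1 at 1; rewrite P2 at 1; ring. }
  assert (E2 : b2 (actB h p) = wd p a / wd r a * b2 (actB h r) + wd r p / wd r a * b2 (actB h a)).
  { simpl; rewrite P1 at 1; rewrite P2 at 1; ring. }
  unfold wd at 1; rewrite E1, E2, R1, R2, A1, A2.
  transitivity (((lr * wd p a) * wd r q + (la * wd r p) * wd a q) / wd r a * wd r a);
    [unfold wd in *; field; exact N|field; exact N].
Qed.

(** Orthogonality makes the ends of the axis harmonic with respect to [p], [q], which gives [h]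
    equal diagonal entries in this basis. The side to which [h] moves the foot point fixes the signs
    of the off-diagonal entries, and [ka] is the sign of half the trace. *)
Lemma SQ_coords (l l' : Geod) (sg : R) (h : SL2) :
  (sg = 1 \/ sg = -1) -> faces sg (ge1 l) (ge2 l) (ge1 l') (ge2 l') ->
  SQ l (posside l l') h ->
  exists ka c mu nu, (ka = 1 \/ ka = -1) /\ 1 < c /\ 0 < mu /\ 0 < nu /\
    b1 (actB h (ge1 l)) = ka * (c * b1 (ge1 l) + sg * nu * b1 (ge2 l)) /\
    b2 (actB h (ge1 l)) = ka * (c * b2 (ge1 l) + sg * nu * b2 (ge2 l)) /\
    b1 (actB h (ge2 l)) = ka * (c * b1 (ge2 l) + sg * mu * b1 (ge1 l)) /\
    b2 (actB h (ge2 l)) = ka * (c * b2 (ge2 l) + sg * mu * b2 (ge1 l)).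
Proof.
  intros Hsg Hf (Hh & z & (Hz & r & a & Hr & Ha & Hra & Horth) & Hp).
  apply (posside_iff _ _ sg _ Hf) in Hp.
  destruct Hr as (lr & Lr & R1 & R2), Ha as (la & La & A1 & A2).
  destruct (onG_form _ _ Hz) as (s & t & Hs & Ht & F).
  set (p := ge1 l) in *; set (q := ge2 l) in *.
  pose proof (ge_wd l) as W; fold p q in W.
  (* [r] and [a] belong to different eigenvalues. *)
  assert (N : wd r a <> 0).
  { intros N; destruct (wd_parallel _ _ N) as (k & Hk & K1 & K2).
    assert (Ek : (la - lr) * b1 a = 0 /\ (la - lr) * b2 a = 0).
    { split; [transitivity (la * b1 a - k * (lr * b1 r)); [rewrite K1; ring|]
             |transitivity (la * b2 a - k * (lr * b2 r)); [rewrite K2; ring|]].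
      - rewrite <- A1, <- R1, K1, K2; ring.
      - rewrite <- A2, <- R2, K1, K2; ring. }
    assert (la - lr <> 0) by (intros E; replace la with lr in La by lra; lra).
    destruct Ek as [Z1 Z2]. apply Rmult_integral in Z1, Z2.
    pose proof (Bpt_norm_pos a) as Na. destruct Z1 as [?|Z1], Z2 as [?|Z2]; try tauto.
    rewrite Z1, Z2 in Na; lra. }
  pose proof (grad_product r a p q _ _ Hra Hz) as G. rewrite Horth in G.
  rewrite !(Fq_form _ _ _ _ _ _ _ F), !wd_self, (wd_anti p q) in G.
  (* Harmonicity of the pairs [r], [a] and [p], [q]. *)
  assert (H1 : wd r q * wd a p + wd r p * wd a q = 0).
  { apply (Rmult_eq_reg_l (s * t * wd p q ^ 2)).
    - rewrite Rmult_0_r. lra.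
    - pose proof (sqr_pos _ W). assert (0 < s * t) by now apply Rmult_lt_0_compat. nra. }
  assert (Eq : wd (actB h p) q = wd p (actB h q)).
  { apply (Rmult_eq_reg_r (wd r a)); trivial.
    rewrite (wd_anti _ p), (wd_eigen h r a p q lr la), Ropp_mult_distr_l_reverse,
      (wd_eigen h r a q p lr la), (wd_anti a p), (wd_anti a q) by assumption.
    apply Rminus_diag_uniq.
    transitivity ((la - lr) * (wd r q * wd a p + wd r p * wd a q)); [ring|rewrite H1; ring]. }
  set (c := (ma h + md h) / 2).
  assert (Ec : wd (actB h p) q = c * wd p q).
  { pose proof (trace_wd h p q). unfold c; lra. }
  assert (Ec' : wd p (actB h q) = c * wd p q) by lra.
  destruct (wd_coords (actB h p) p q W) as [P1 P2].
  destruct (wd_coords (actB h q) p q W) as [Q1 Q2].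
  rewrite Ec in P1, P2; rewrite Ec' in Q1, Q2.
  set (nu := wd p (actB h p) / wd p q) in *. set (mu := wd (actB h q) q / wd p q) in *.
  replace (c * wd p q / wd p q) with c in * by (field; exact W).
  assert (Hc : 1 < c ^ 2).
  { unfold hyperbolic in Hh. assert (1 < Rabs c).
    { unfold c, Rdiv; rewrite Rabs_mult, (Rabs_pos_eq (/ 2)) by lra. lra. }
    rewrite <- pow2_abs; nra. }
  assert (Hd : c ^ 2 - mu * nu = 1).
  { apply (Rmult_eq_reg_r (wd p q)); trivial.
    transitivity (wd (actB h p) (actB h q)); [|rewrite wd_act; ring].
    unfold wd at 2; rewrite P1, P2, Q1, Q2; unfold wd; ring. }
  apply (form_act h) in F. rewrite (Fq_form _ _ _ _ _ _ _ F) in Hp.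
  assert (V1 : wd p (actB h p) = nu * wd p q) by (unfold nu; field; exact W).
  assert (V2 : wd (actB h q) q = mu * wd p q) by (unfold mu; field; exact W).
  rewrite V1, (wd_anti _ q), (wd_anti _ q), Ec, Ec', V2 in Hp.
  pose proof (act_den_pos h z) as Dp.
  assert (Hp' : 0 < s * (sg * c * nu) + t * (sg * c * mu)).
  { pose proof (sqr_pos _ W) as W2.
    apply (Rmult_lt_reg_l (wd p q ^ 2 / act_den h z)); [now apply Rdiv_lt_0_compat|].
    rewrite Rmult_0_r. apply Ropp_lt_cancel. rewrite Ropp_0.
    eapply Rle_lt_trans; [|exact Hp]. apply Req_le; field; lra. }
  (* Since [mu nu = c^2 - 1] is positive, both summands of [Hp'] have one sign, which must be
     positive. *)
  assert (Hpr : 0 < (sg * c * nu) * (sg * c * mu)).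
  { replace (sg * c * nu * (sg * c * mu)) with ((sg * sg) * (c ^ 2 * (mu * nu))) by ring.
    apply Rmult_lt_0_compat; [destruct Hsg as [-> | ->]; lra|].
    apply Rmult_lt_0_compat; lra. }
  assert (Hnu : 0 < sg * c * nu).
  { apply Rnot_le_lt; intros Q.
    assert (sg * c * nu < 0) by (destruct Q as [?|Q]; [trivial|rewrite Q in Hpr; lra]).
    assert (sg * c * mu < 0) by nra. nra. }
  assert (Hmu : 0 < sg * c * mu) by (apply (Rmult_lt_reg_l (sg * c * nu)); lra).
  assert (Hsg2 : sg * sg = 1) by (destruct Hsg as [-> | ->]; lra).
  destruct (Rlt_le_dec 0 c) as [Pc|Nc].
  - exists 1, c, (sg * mu), (sg * nu); split; [auto|].
    split; [nra|]. split; [apply (Rmult_lt_reg_l c); lra|].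
    split; [apply (Rmult_lt_reg_l c); lra|].
    replace (sg * (sg * nu)) with nu by (rewrite <- Rmult_assoc, Hsg2; ring).
    replace (sg * (sg * mu)) with mu by (rewrite <- Rmult_assoc, Hsg2; ring).
    rewrite P1, P2, Q1, Q2; repeat split; ring.
  - exists (-1), (- c), (- (sg * mu)), (- (sg * nu)); split; [auto|].
    split; [nra|]. assert (c <> 0) by (intros ->; lra).
    split; [apply (Rmult_lt_reg_l (- c)); lra|].
    split; [apply (Rmult_lt_reg_l (- c)); lra|].
    replace (sg * - (sg * nu)) with (- nu)
      by (transitivity (- (sg * sg * nu)); [rewrite Hsg2|]; ring).
    replace (sg * - (sg * mu)) with (- mu)
      by (transitivity (- (sg * sg * mu)); [rewrite Hsg2|]; ring).
    rewrite P1, P2, Q1, Q2; repeat split; ring.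
Qed.

(** The eigenvectors are [al p + be q] and [al p - be q] with [al^2 = mu] and [be^2 = nu], for the
    eigenvalues [c + m] and [c - m] with [m^2 = mu nu]. The axis crosses [l] orthogonally at the
    point with weights proportional to [mu] and [nu]. *)
Lemma SQ_of_coords (l l' : Geod) (sg c mu nu : R) (h : SL2) :
  (sg = 1 \/ sg = -1) -> faces sg (ge1 l) (ge2 l) (ge1 l') (ge2 l') ->
  1 < c -> 0 < mu -> 0 < nu -> c ^ 2 - mu * nu = 1 ->
  b1 (actB h (ge1 l)) = c * b1 (ge1 l) + sg * nu * b1 (ge2 l) ->
  b2 (actB h (ge1 l)) = c * b2 (ge1 l) + sg * nu * b2 (ge2 l) ->
  b1 (actB h (ge2 l)) = c * b1 (ge2 l) + sg * mu * b1 (ge1 l) ->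
  b2 (actB h (ge2 l)) = c * b2 (ge2 l) + sg * mu * b2 (ge1 l) ->
  SQ l (posside l l') h.
Proof.
  intros Hsg Hf Hc Hmu Hnu Hd P1 P2 Q1 Q2.
  pose proof (ge_wd l) as W.
  destruct (geod_pt l mu nu Hmu Hnu) as (z & k & Hk & F).
  set (p := ge1 l) in *; set (q := ge2 l) in *.
  assert (Hsg2 : sg * sg = 1) by (destruct Hsg as [-> | ->]; lra).
  (* The sign in [be] makes [m] positive, so that [al p + be q] is the attracting end. *)
  set (al := sqrt mu); set (be := sg * sqrt nu).
  assert (Eal : al * al = mu) by (apply sqrt_sqrt; lra).
  assert (Ebe : be * be = nu).
  { unfold be; transitivity (sg * sg * (sqrt nu * sqrt nu)); [ring|].
    rewrite Hsg2, sqrt_sqrt; lra. }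
  assert (Hal : 0 < al) by now apply sqrt_lt_R0.
  assert (Hbe : 0 < sg * be).
  { unfold be; rewrite <- Rmult_assoc, Hsg2, Rmult_1_l; now apply sqrt_lt_R0. }
  assert (Hbe0 : be <> 0) by (intros E; rewrite E in Hbe; lra).
  set (m := sg * al * be) in *.
  assert (Hm : 0 < m) by (replace m with (al * (sg * be)) by (unfold m; ring); nra).
  assert (Em : m * m = mu * nu).
  { rewrite <- Eal, <- Ebe.
    transitivity (sg * sg * (al * al * (be * be))); [unfold m; ring|rewrite Hsg2; ring]. }
  assert (nz : forall b, b <> 0 ->
    ~ (al * b1 p + b * b1 q = 0 /\ al * b2 p + b * b2 q = 0)).
  { intros b Hb [Z1 Z2]. apply Hb, (Rmult_eq_reg_r (wd p q)); trivial.
    transitivity (b1 p * (al * b2 p + b * b2 q) - b2 p * (al * b1 p + b * b1 q));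
      [unfold wd; ring|rewrite Z1, Z2; ring]. }
  set (a := mkB _ _ (nz be Hbe0)).
  set (r := mkB _ _ (nz (- be) ltac:(lra))).
  assert (Emu : sg * mu * be = al * m)
    by (rewrite <- Eal; unfold m; ring).
  assert (Enu : sg * nu * al = be * m)
    by (rewrite <- Ebe; unfold m; ring).
  assert (eig : forall v b ka, ka * ka = 1 -> b = ka * be ->
    b1 v = al * b1 p + b * b1 q -> b2 v = al * b2 p + b * b2 q ->
    ma h * b1 v + mb h * b2 v = (c + ka * m) * b1 v /\
    mc h * b1 v + md h * b2 v = (c + ka * m) * b2 v).
  { simpl in P1, P2, Q1, Q2. intros v b ka Hka -> -> ->. split.
    - transitivity (al * (ma h * b1 p + mb h * b2 p) + ka * be * (ma h * b1 q + mb h * b2 q));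
        [ring|rewrite P1, Q1].
      transitivity (c * al * b1 p + ka * (sg * mu * be) * b1 p
                    + c * ka * be * b1 q + sg * nu * al * b1 q); [ring|].
      rewrite Emu, Enu.
      replace (be * m * b1 q) with (ka * ka * (be * m * b1 q)) by (rewrite Hka; ring). ring.
    - transitivity (al * (mc h * b1 p + md h * b2 p) + ka * be * (mc h * b1 q + md h * b2 q));
        [ring|rewrite P2, Q2].
      transitivity (c * al * b2 p + ka * (sg * mu * be) * b2 p
                    + c * ka * be * b2 q + sg * nu * al * b2 q); [ring|].
      rewrite Emu, Enu.
      replace (be * m * b2 q) with (ka * ka * (be * m * b2 q)) by (rewrite Hka; ring). ring. }
  assert (Ha : attracting_pt h a).
  { exists (c + 1 * m); split; [rewrite Rabs_pos_eq; lra|].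
    apply (eig a be 1); trivial; ring. }
  assert (Hr : repelling_pt h r).
  { exists (c + -1 * m); split; [|apply (eig r (- be) (-1)); trivial; ring].
    assert (I : (c + m) * (c + -1 * m) = 1) by lra.
    assert (0 < c + -1 * m) by (apply (Rmult_lt_reg_l (c + m)); lra).
    rewrite Rabs_pos_eq by lra.
    apply (Rmult_lt_reg_l (c + m)); lra. }
  assert (Hon : onG l z) by (eapply form_onG, F).
  assert (S1 : wd r p = be * wd p q) by (unfold wd; simpl; ring).
  assert (S2 : wd a p = - be * wd p q) by (unfold wd; simpl; ring).
  assert (S3 : wd r q = al * wd p q) by (unfold wd; simpl; ring).
  assert (S4 : wd a q = al * wd p q) by (unfold wd; simpl; ring).
  assert (Hra : Fq r a (hx z) (hy z) = 0).
  { rewrite (Fq_form _ _ _ _ _ _ _ F), S1, S2, S3, S4, <- Eal, <- Ebe. ring. }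
  split; [|exists z; split; [split; [exact Hon|]|]].
  - unfold hyperbolic.
    assert (T : ma h + md h = 2 * c).
    { apply (Rmult_eq_reg_r (wd p q)); trivial. rewrite trace_wd.
      unfold wd; rewrite P1, P2, Q1, Q2; ring. }
    rewrite T, Rabs_pos_eq; lra.
  - exists r, a; split; [exact Hr|split; [exact Ha|split; [exact Hra|]]].
    pose proof (hy_pos z) as Y. pose proof (sqr_pos (hy z) ltac:(lra)) as Y2.
    apply (Rmult_eq_reg_l (hy z ^ 2)); [|lra].
    fold p q; rewrite (grad_product r a p q _ _ Hra Hon), !(Fq_form _ _ _ _ _ _ _ F), !wd_self,
      (wd_anti p q), S1, S2, S3, S4. ring.
  - apply (posside_iff _ _ sg _ Hf).
    apply (form_act h) in F; rewrite (Fq_form _ _ _ _ _ _ _ F).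
    pose proof (act_den_pos h z) as Dp. pose proof (sqr_pos _ W) as W2.
    fold p q.
    assert (T1 : wd p (actB h p) = sg * nu * wd p q) by (unfold wd; rewrite P1, P2; ring).
    assert (T2 : wd q (actB h p) = - c * wd p q) by (unfold wd; rewrite P1, P2; ring).
    assert (T3 : wd p (actB h q) = c * wd p q) by (unfold wd; rewrite Q1, Q2; ring).
    assert (T4 : wd q (actB h q) = - (sg * mu) * wd p q) by (unfold wd; rewrite Q1, Q2; ring).
    rewrite T1, T2, T3, T4.
    apply Ropp_lt_cancel; rewrite Ropp_0.
    apply Rlt_le_trans with ((sg * sg) * (2 * (mu * nu) * (k * c * wd p q ^ 2 / act_den h z))).
    + rewrite Hsg2. assert (0 < mu * nu) by now apply Rmult_lt_0_compat.
      assert (0 < k * c) by (apply Rmult_lt_0_compat; lra).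
      assert (0 < k * c * wd p q ^ 2) by now apply Rmult_lt_0_compat.
      assert (0 < k * c * wd p q ^ 2 / act_den h z) by now apply Rdiv_lt_0_compat.
      nra.
    + apply Req_le; field; lra.
Qed.

(** * Stem quadrants and the four inequalities *)

Lemma faces_images (l l' : Geod) (g g' : SL2) (sg : R) (z : Hpt) :
  faces sg (ge1 l) (ge2 l) (ge1 l') (ge2 l') -> posside l l' z ->
  (forall z', onG l' z' -> opp_side (gmap g l) (act g z) (act g' z')) ->
  faces sg (actB g (ge1 l)) (actB g (ge2 l)) (actB g' (ge1 l')) (actB g' (ge2 l')).
Proof.
  intros F Hz H; apply (posside_iff _ _ sg _ F) in Hz.
  (* The image of one positive [z] is compared with the images of all points of [l'], that is, of
     all positive weights; [Fq_act] carries the sign at [z] over to its image. *)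
  apply nonneg_of_cone; intros s r Hs Hr.
  destruct (geod_pt l' s r Hs Hr) as (z' & k & Hk & Fz').
  pose proof (H z' (form_onG _ _ _ _ Fz')) as O; unfold opp_side in O; simpl ge1 in O; simpl ge2 in O.
  rewrite <- (Fq_act g) in Hz.
  rewrite (Fq_form _ _ _ _ _ _ _ (form_act g' _ _ _ _ _ Fz')) in O.
  pose proof (act_den_pos g z) as D. pose proof (act_den_pos g' z') as D'.
  set (x := Fq (actB g (ge1 l)) (actB g (ge2 l)) (hx (act g z)) (hy (act g z))) in *.
  set (X := wd (actB g (ge1 l)) (actB g' (ge1 l')) * wd (actB g (ge2 l)) (actB g' (ge1 l'))) in *.
  set (Y := wd (actB g (ge1 l)) (actB g' (ge2 l')) * wd (actB g (ge2 l)) (actB g' (ge2 l'))) in *.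
  assert (Sx : 0 < - sg * x) by (apply (Rmult_lt_reg_r (act_den g z)); lra).
  rewrite Rmult_comm in O; apply (opposite_sign_iff (- sg)) in O; [|exact Sx].
  apply (Rmult_lt_reg_l (k / act_den g' z')); [now apply Rdiv_lt_0_compat|].
  rewrite Rmult_0_r.
  replace (k / act_den g' z' * (s * (sg * X) + r * (sg * Y)))
    with (- (- sg * (k * s / act_den g' z' * X + k * r / act_den g' z' * Y))) by (field; lra).
  lra.
Qed.

(** The relation says that [g' b] is [g a] up to sign. *)
Lemma wd_sqr_of_peq (g g' a b : SL2) (x y : Bpt) :
  peq (smul (sinv g) g') (smul a (sinv b)) ->
  wd (actB g (actB a x)) (actB g' (actB b y)) ^ 2 = wd x y ^ 2.
Proof.
  intros H; apply peq_cases in H.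
  rewrite <- (wd_act (smul g a) x y).
  assert (E : smul g' b = smul g a \/ smul g' b = sneg (smul g a)).
  { rewrite <- (smul_sinvKV g g') at 1 2.
    destruct H as [-> | ->]; [left|right]; rewrite ?smul_sneg, ?sneg_smul, <- !smulA,
      smul_sinv_l, smul_sone; reflexivity. }
  transitivity (wd (actB (smul g a) x) (actB (smul g' b) y) ^ 2); [unfold wd; simpl; ring|].
  destruct E as [-> | ->]; [reflexivity|unfold wd; simpl; ring].
Qed.

Lemma wd_comb (g g' : SL2) (x y p q p' q' : Bpt) (s t s' t' : R) :
  b1 x = s * b1 p + t * b1 q -> b2 x = s * b2 p + t * b2 q ->
  b1 y = s' * b1 p' + t' * b1 q' -> b2 y = s' * b2 p' + t' * b2 q' ->
  wd (actB g x) (actB g' y)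
  = s * s' * wd (actB g p) (actB g' p') + s * t' * wd (actB g p) (actB g' q')
    + t * s' * wd (actB g q) (actB g' p') + t * t' * wd (actB g q) (actB g' q').
Proof. unfold wd; simpl; intros -> -> -> ->; ring. Qed.

(** The coefficient of [e] exceeds one and the others are positive, so the sum exceeds [e]; when
    [e = 0], another entry is positive. *)
Lemma sqr_lt_of_growth (ka w w' s s' t t' e f g h : R) :
  ka ^ 2 = 1 -> w' = ka * e -> w ^ 2 = (s * s' * e + s * t' * f + t * s' * g + t * t' * h) ^ 2 ->
  1 < s -> 1 < s' -> 0 < t -> 0 < t' ->
  0 <= e -> 0 <= f -> 0 <= g -> 0 <= h -> 0 < e + f + g + h -> w' ^ 2 < w ^ 2.
Proof.
  intros K -> -> Hs Hs' Ht Ht' He Hf Hg Hh Hp.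
  rewrite Rpow_mult_distr, K, Rmult_1_l.
  assert (H1 : 1 < s * s') by nra.
  assert (0 < s * t') by nra. assert (0 < t * s') by nra. assert (0 < t * t') by nra.
  assert (0 <= (s * s' - 1) * e) by (apply Rmult_le_pos; lra).
  assert (0 <= s * t' * f) by (apply Rmult_le_pos; lra).
  assert (0 <= t * s' * g) by (apply Rmult_le_pos; lra).
  assert (0 <= t * t' * h) by (apply Rmult_le_pos; lra).
  assert (e < s * s' * e + s * t' * f + t * s' * g + t * t' * h).
  { destruct He as [He|He].
    - assert (0 < (s * s' - 1) * e) by (apply Rmult_lt_0_compat; lra). lra.
    - destruct Hf as [Hf|Hf].
      + assert (0 < s * t' * f) by (apply Rmult_lt_0_compat; lra). lra.
      + destruct Hg as [Hg|Hg].
        * assert (0 < t * s' * g) by (apply Rmult_lt_0_compat; lra). lra.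
        * assert (0 < t * t' * h) by (apply Rmult_lt_0_compat; lra). lra. }
  nra.
Qed.

(** The orientation hypotheses give [faces] for the images with the same [sg] and [sg'] as for [l]
    and [l']. Hence one normalisation of signs makes the pairings of the images nonnegative and the
    entries of [a] and [b] positive. *)
Lemma all_shrink_of_SQ (l l' : Geod) (g g' a b : SL2) :
  (forall z z', posside l l' z -> onG l' z' -> opp_side (gmap g l) (act g z) (act g' z')) ->
  (forall z' z, posside l' l z' -> onG l z -> opp_side (gmap g' l') (act g' z') (act g z)) ->
  geod_disjoint l l' -> SQ l (posside l l') a -> SQ l' (posside l' l) b ->
  peq (smul (sinv g) g') (smul a (sinv b)) -> all_shrink l l' g g'.
Proof.
  intros O O' Hd Ha Hb E.
  assert (Hd' : geod_disjoint l' l) by (intros z [H1 H2]; now apply (Hd z)).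
  destruct (disjoint_faces l l' Hd) as (sg & Hsg & F).
  destruct (disjoint_faces l' l Hd') as (sg' & Hsg' & F').
  assert (G : faces sg (actB g (ge1 l)) (actB g (ge2 l)) (actB g' (ge1 l')) (actB g' (ge2 l'))).
  { destruct Ha as (_ & z & _ & Hz). exact (faces_images l l' g g' sg _ F Hz (fun z' => O _ z' Hz)). }
  assert (G' : faces sg' (actB g' (ge1 l')) (actB g' (ge2 l')) (actB g (ge1 l)) (actB g (ge2 l))).
  { destruct Hb as (_ & z & _ & Hz). exact (faces_images l' l g' g sg' _ F' Hz (fun z' => O' _ z' Hz)). }
  destruct (faces_sym _ _ _ _ _ _ Hsg Hsg' G G') as (ep & Hep & E1 & E2 & E3 & E4).
  destruct (SQ_coords l l' sg a Hsg F Ha)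
    as (ka & c & mu & nu & Hka & Hc & Hmu & Hnu & P1 & P2 & Q1 & Q2).
  destruct (SQ_coords l' l sg' b Hsg' F' Hb)
    as (ka' & c' & mu' & nu' & Hka' & Hc' & Hmu' & Hnu' & P1' & P2' & Q1' & Q2').
  set (p := ge1 l) in *; set (q := ge2 l) in *.
  set (p' := ge1 l') in *; set (q' := ge2 l') in *.
  pose proof (wd_sqr_of_peq g g' a b p p' E) as W11.
  pose proof (wd_sqr_of_peq g g' a b p q' E) as W12.
  pose proof (wd_sqr_of_peq g g' a b q p' E) as W21.
  pose proof (wd_sqr_of_peq g g' a b q q' E) as W22.
  rewrite Rmult_plus_distr_l, <- !Rmult_assoc in P1, P2, Q1, Q2, P1', P2', Q1', Q2'.
  rewrite (wd_comb g g' _ _ _ _ _ _ _ _ _ _ P1 P2 P1' P2') in W11.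
  rewrite (wd_comb g g' _ _ _ _ _ _ _ _ _ _ P1 P2 Q1' Q2') in W12.
  rewrite (wd_comb g g' _ _ _ _ _ _ _ _ _ _ Q1 Q2 P1' P2') in W21.
  rewrite (wd_comb g g' _ _ _ _ _ _ _ _ _ _ Q1 Q2 Q1' Q2') in W22.
  unfold all_shrink; fold p q p' q'.
  destruct G as (_ & _ & G).
  set (w11 := wd (actB g p) (actB g' p')) in *. set (w12 := wd (actB g p) (actB g' q')) in *.
  set (w21 := wd (actB g q) (actB g' p')) in *. set (w22 := wd (actB g q) (actB g' q')) in *.
  (* [faces] for the images prevents [w11] and [w12] from vanishing together. *)
  assert (S : 0 < ep * w11 + ep * (sg' * w12) + ep * (sg * w21) + ep * (sg * sg' * w22)).
  { apply Rnot_le_lt; intros N.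
    assert (Z1 : ep * w11 = 0) by lra. assert (Z2 : ep * (sg' * w12) = 0) by lra.
    assert (w11 = 0) by (destruct Hep as [-> | ->]; lra).
    assert (w12 = 0) by (destruct Hep as [-> | ->], Hsg' as [-> | ->]; lra).
    replace w11 with 0 in G by lra. replace w12 with 0 in G by lra. lra. }
  clearbody w11 w12 w21 w22.
  repeat split.
  - apply (sqr_lt_of_growth ep _ _ c c' nu nu'
             (ep * w11) (ep * (sg' * w12)) (ep * (sg * w21)) (ep * (sg * sg' * w22)));
      [| |rewrite <- W11|lra..];
      destruct Hka as [-> | ->], Hka' as [-> | ->], Hep as [-> | ->],
        Hsg as [-> | ->], Hsg' as [-> | ->]; ring.
  - apply (sqr_lt_of_growth (ep * sg') _ _ c c' nu mu'
             (ep * (sg' * w12)) (ep * w11) (ep * (sg * sg' * w22)) (ep * (sg * w21)));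
      [| |rewrite <- W12|lra..];
      destruct Hka as [-> | ->], Hka' as [-> | ->], Hep as [-> | ->],
        Hsg as [-> | ->], Hsg' as [-> | ->]; ring.
  - apply (sqr_lt_of_growth (ep * sg) _ _ c c' mu nu'
             (ep * (sg * w21)) (ep * (sg * sg' * w22)) (ep * w11) (ep * (sg' * w12)));
      [| |rewrite <- W21|lra..];
      destruct Hka as [-> | ->], Hka' as [-> | ->], Hep as [-> | ->],
        Hsg as [-> | ->], Hsg' as [-> | ->]; ring.
  - apply (sqr_lt_of_growth (ep * (sg * sg')) _ _ c c' mu mu'
             (ep * (sg * sg' * w22)) (ep * (sg * w21)) (ep * (sg' * w12)) (ep * w11));
      [| |rewrite <- W22|lra..];
      destruct Hka as [-> | ->], Hka' as [-> | ->], Hep as [-> | ->],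
        Hsg as [-> | ->], Hsg' as [-> | ->]; ring.
Qed.

(** Pairing with [p] and [q] separates vectors, so [h] is multiplication by [ka] on the basis [p'],
    [q']. *)
Lemma scalar_on_basis (h : SL2) (ka : R) (p q p' q' : Bpt) :
  (ka = 1 \/ ka = -1) -> wd p q <> 0 -> wd p' q' <> 0 ->
  wd p (actB h p') = ka * wd p p' -> wd q (actB h p') = ka * wd q p' ->
  wd p (actB h q') = ka * wd p q' -> wd q (actB h q') = ka * wd q q' ->
  h = sone \/ h = sneg sone.
Proof.
  intros Hka W W' P1 P2 Q1 Q2.
  assert (sc : forall y, wd p (actB h y) = ka * wd p y -> wd q (actB h y) = ka * wd q y ->
    b1 (actB h y) - ka * b1 y = 0 /\ b2 (actB h y) - ka * b2 y = 0).
  { intros y H1 H2; apply (wd_basis p q _ _ W); unfold wd in *; lra. }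
  destruct (sc p' P1 P2) as [A1 A2], (sc q' Q1 Q2) as [B1 B2]; simpl in *.
  destruct (wd_basis p' q' (- mb h) (ma h - ka) W') as [C1 C2]; [lra|lra|].
  destruct (wd_basis p' q' (- (md h - ka)) (mc h) W') as [D1 D2]; [lra|lra|].
  destruct Hka as [-> | ->]; [left|right]; apply SL2_eq; simpl; lra.
Qed.

Lemma peq_of_wd (g g' a b : SL2) (ka : R) (p q p' q' : Bpt) :
  (ka = 1 \/ ka = -1) -> wd p q <> 0 -> wd p' q' <> 0 ->
  (forall x y, (x = p \/ x = q) -> (y = p' \/ y = q') ->
     wd (actB g (actB a x)) (actB g' (actB b y)) = ka * wd x y) ->
  peq (smul (sinv g) g') (smul a (sinv b)).
Proof.
  intros Hka W W' H.
  set (m := smul (sinv (smul g a)) (smul g' b)).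
  assert (Hm : forall x y, (x = p \/ x = q) -> (y = p' \/ y = q') ->
               wd x (actB m y) = ka * wd x y).
  { intros x y Hx Hy; unfold m; rewrite <- wd_smul_sinv, <- H by assumption.
    unfold wd; simpl; ring. }
  assert (E : smul g' b = smul (smul g a) m) by (symmetry; apply smul_sinvKV).
  rewrite <- (smul_K_sinv g' b), E; apply peq_cases.
  destruct (scalar_on_basis m ka p q p' q') as [-> | ->]; auto; [left|right];
    rewrite ?smul_sneg, ?sneg_smul, ?smul_sneg, smul_sone, <- smulA, smul_sinvK; reflexivity.
Qed.

(** With the signs of [faces_sym], the pairings of the endpoints are nonnegative and strictly
    dominate those of the images in absolute value. The factorisation, up to an overall sign [ka],
    then gives the entries of [a] and [b] in the endpoint bases. *)
Lemma SQ_of_all_shrink (l l' : Geod) (g g' : SL2) :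
  all_shrink l l' g g' ->
  exists a b, SQ l (posside l l') a /\ SQ l' (posside l' l) b /\
              peq (smul (sinv g) g') (smul a (sinv b)).
Proof.
  intros Hs. pose proof (all_shrink_disjoint _ _ _ _ Hs) as Hd.
  assert (Hd' : geod_disjoint l' l) by (intros z [H1 H2]; now apply (Hd z)).
  destruct (disjoint_faces l l' Hd) as (sg & Hsg & F).
  destruct (disjoint_faces l' l Hd') as (sg' & Hsg' & F').
  destruct (faces_sym _ _ _ _ _ _ Hsg Hsg' F F') as (ep & Hep & E1 & E2 & E3 & E4).
  pose proof (ge_wd l) as W. pose proof (ge_wd l') as W'.
  destruct Hs as [[A B] [C D]].
  (* By this relation both matrices of pairings have the nonzero determinant [(p ^ q) (p' ^ q')]. *)
  assert (Pl : forall u v x y, wd u x * wd v y - wd u y * wd v x = wd u v * wd x y)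
    by (intros; unfold wd; ring).
  set (p := ge1 l) in *; set (q := ge2 l) in *.
  set (p' := ge1 l') in *; set (q' := ge2 l') in *.
  pose proof (Pl p q p' q') as K.
  pose proof (Pl (actB g p) (actB g q) (actB g' p') (actB g' q')) as K'.
  rewrite !wd_act, <- K in K'.
  assert (N : wd p p' * wd q q' - wd p q' * wd q p' <> 0)
    by (rewrite K; now apply Rmult_integral_contrapositive).
  set (u11 := wd p p') in *; set (u12 := wd p q') in *.
  set (u21 := wd q p') in *; set (u22 := wd q q') in *.
  set (w11 := wd (actB g p) (actB g' p')) in *. set (w12 := wd (actB g p) (actB g' q')) in *.
  set (w21 := wd (actB g q) (actB g' p')) in *. set (w22 := wd (actB g q) (actB g' q')) in *.
  assert (ab : forall k u w, (k = 1 \/ k = -1) -> w ^ 2 < u ^ 2 -> 0 <= k * u -> Rabs (k * w) < k * u).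
  { intros k u w Hk Hw Hu. apply Rabs_def1; destruct Hk as [-> | ->]; nra. }
  assert (S2 : ep * sg' = 1 \/ ep * sg' = -1)
    by (destruct Hep as [-> | ->], Hsg' as [-> | ->]; lra).
  assert (S3 : ep * sg = 1 \/ ep * sg = -1)
    by (destruct Hep as [-> | ->], Hsg as [-> | ->]; lra).
  assert (S4 : ep * (sg * sg') = 1 \/ ep * (sg * sg') = -1)
    by (destruct Hep as [-> | ->], Hsg as [-> | ->], Hsg' as [-> | ->]; lra).
  rewrite <- Rmult_assoc in E2, E3, E4.
  assert (Dt : forall x y z t, ep * x * (ep * (sg * sg') * t) - ep * sg' * y * (ep * sg * z)
               = sg * sg' * (x * t - y * z))
    by (intros; destruct Hep as [-> | ->]; ring).
  assert (PD : exists ka, (ka = 1 \/ ka = -1) /\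
    product_decomposition (ep * u11) (ep * sg' * u12) (ep * sg * u21) (ep * (sg * sg') * u22)
      (ka * (ep * w11)) (ka * (ep * sg' * w12)) (ka * (ep * sg * w21))
      (ka * (ep * (sg * sg') * w22))).
  { destruct (product_decomposition_up_to_sign
      (ep * u11) (ep * sg' * u12) (ep * sg * u21) (ep * (sg * sg') * u22)
      (ep * w11) (ep * sg' * w12) (ep * sg * w21) (ep * (sg * sg') * w22)) as [PD|PD];
      auto.
    - rewrite !Dt, K'; reflexivity.
    - rewrite Dt; destruct Hsg as [-> | ->], Hsg' as [-> | ->]; lra.
    - exists 1; split; [auto|]. now rewrite !Rmult_1_l.
    - exists (-1); split; [auto|].
      now replace (-1) with (- (1)) by ring; rewrite <- !Ropp_mult_distr_l, !Rmult_1_l. }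
  destruct PD as (ka & Hka & c & mu & nu & mu' & nu' & Hc & Hmu & Hnu & Hmu' & Hnu'
                  & Ed & Ed' & R1 & R2 & R3 & R4).
  assert (Sg2 : sg * sg = 1) by (destruct Hsg as [-> | ->]; ring).
  assert (Sg2' : sg' * sg' = 1) by (destruct Hsg' as [-> | ->]; ring).
  destruct (SL2_of_images p q (c * b1 p + sg * nu * b1 q) (c * b2 p + sg * nu * b2 q)
     (c * b1 q + sg * mu * b1 p) (c * b2 q + sg * mu * b2 p) W)
    as (a & [P1 P2] & [Q1 Q2]).
  { transitivity ((c ^ 2 - sg * sg * (mu * nu)) * wd p q); [unfold wd; ring|].
    rewrite Sg2, Rmult_1_l, Ed; ring. }
  destruct (SL2_of_images p' q' (c * b1 p' + sg' * nu' * b1 q') (c * b2 p' + sg' * nu' * b2 q')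
     (c * b1 q' + sg' * mu' * b1 p') (c * b2 q' + sg' * mu' * b2 p') W')
    as (b & [P1' P2'] & [Q1' Q2']).
  { transitivity ((c ^ 2 - sg' * sg' * (mu' * nu')) * wd p' q'); [unfold wd; ring|].
    rewrite Sg2', Rmult_1_l, Ed'; ring. }
  exists a, b; split; [|split].
  - exact (SQ_of_coords l l' sg c mu nu a Hsg F Hc Hmu Hnu Ed P1 P2 Q1 Q2).
  - exact (SQ_of_coords l' l sg' c mu' nu' b Hsg' F' Hc Hmu' Hnu' Ed' P1' P2' Q1' Q2').
  - apply (peq_of_wd g g' a b ka p q p' q' Hka W W').
    intros x y [-> | ->] [-> | ->].
    + rewrite (wd_comb g g' _ _ _ _ _ _ _ _ _ _ P1 P2 P1' P2'); fold u11 w11 w12 w21 w22.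
      revert R1. clear - Hep Hsg Hsg' Hka.
      destruct Hep as [-> | ->], Hsg as [-> | ->], Hsg' as [-> | ->], Hka as [-> | ->]; intros; lra.
    + rewrite (wd_comb g g' _ _ _ _ _ _ _ _ _ _ P1 P2 Q1' Q2'); fold u12 w11 w12 w21 w22.
      revert R2. clear - Hep Hsg Hsg' Hka.
      destruct Hep as [-> | ->], Hsg as [-> | ->], Hsg' as [-> | ->], Hka as [-> | ->]; intros; lra.
    + rewrite (wd_comb g g' _ _ _ _ _ _ _ _ _ _ Q1 Q2 P1' P2'); fold u21 w11 w12 w21 w22.
      revert R3. clear - Hep Hsg Hsg' Hka.
      destruct Hep as [-> | ->], Hsg as [-> | ->], Hsg' as [-> | ->], Hka as [-> | ->]; intros; lra.
    + rewrite (wd_comb g g' _ _ _ _ _ _ _ _ _ _ Q1 Q2 Q1' Q2'); fold u22 w11 w12 w21 w22.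
      revert R4. clear - Hep Hsg Hsg' Hka.
      destruct Hep as [-> | ->], Hsg as [-> | ->], Hsg' as [-> | ->], Hka as [-> | ->]; intros; lra.
Qed.

Theorem theoremB2 (l l' : Geod) (g g' : SL2) :
  let C := ~ (exists h h' : SL2, Cstar l h /\ Cstar l' h' /\ peq (smul g h) (smul g' h')) in
  let D := geod_disjoint l l' /\
           exists a b : SL2, SQ l (posside l l') a /\ SQ l' (posside l' l) b /\
                             peq (smul (sinv g) g') (smul a (sinv b)) in
  (C -> D) /\
  ((geod_disjoint (gmap g l) (gmap g' l')
    /\ (forall z z', posside l l' z -> onG l' z' -> opp_side (gmap g l) (act g z) (act g' z'))
    /\ (forall z' z, posside l' l z' -> onG l z -> opp_side (gmap g' l') (act g' z') (act g z)))
   -> D -> C).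
Proof.
  intros C D; split.
  - intros H. pose proof (not_meet_all_shrink l l' g g' H) as S.
    split; [exact (all_shrink_disjoint _ _ _ _ S)|exact (SQ_of_all_shrink _ _ _ _ S)].
  - intros (_ & O & O') (Hd & a & b & Ha & Hb & E).
    exact (all_shrink_not_meet _ _ _ _ (all_shrink_of_SQ _ _ _ _ a b O O' Hd Ha Hb E)).
Qed.
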